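(* For every $\varepsilon\in(0,1)$ there exists a constant $C_\varepsilon>0$ depending only on $\varepsilon$ such that the following holds. Let $X=(X_1,\ldots,X_n)$ be a random vector whose coordinates $X_i$ are real-valued independent random variables. Let $t,p\ge 0$ be such that $$\mathcal{L}(X_i,t)\le p\quad\text{for all } i=1,\ldots,n.$$ Let $A$ be a non-zero $m\times n$ real matrix. Then $$\mathcal{L}\big(AX,\,t\|A\|_{\mathrm{HS}}\big)\le (C_\varepsilon\,p)^{(1-\varepsilon)\,r(A)}.$$
   Context: For a random vector $Z$ taking values in $\mathbb{R}^k$, the concentration function is $\mathcal{L}(Z,t)=\max_{u\in\mathbb{R}^k}\mathbb{P}\{\|Z-u\|_2\le t\}$ for $t\ge 0$, where $\|\cdot\|_2$ is the Euclidean norm (for real-valued $X_i$, $k=1$). $\|A\|_{\mathrm{HS}}$ denotes the Hilbert-Schmidt (Frobenius) norm and $\|A\|$ the operator (spectral) norm of $A$. The stable rank of $A$ is defined as $r(A)=\left\lfloor \|A\|_{\mathrm{HS}}^2/\|A\|^2\right\rfloor$. *)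

(* Defs.v *)
From HB Require Import structures.
From mathcomp Require Import all_boot all_order all_algebra.
From mathcomp Require Import all_classical all_reals all_analysis.

Set Implicit Arguments.
Unset Strict Implicit.
Unset Printing Implicit Defensive.

Import Order.TTheory GRing.Theory Num.Theory.
Import numFieldNormedType.Exports.

Local Open Scope classical_set_scope.
Local Open Scope ring_scope.

(* The Hilbert-Schmidt norm.  The norm [`|A|] that MathComp-Analysis puts on
   matrices is the maximum of the absolute values of the entries. *)
Definition hs_norm (R : realType) (m n : nat) (A : 'M[R]_(m, n)) : R :=
  Num.sqrt (\sum_(i < m) \sum_(j < n) A i j ^+ 2).

Definition l2_norm (R : realType) (k : nat) (v : 'cV[R]_k) : R :=
  Num.sqrt (\sum_(i < k) v i 0 ^+ 2).

Definition op_norm (R : realType) (m n : nat) (A : 'M[R]_(m, n)) : R :=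
  sup [set l2_norm (A *m x) | x in [set x : 'cV[R]_n | l2_norm x <= 1]].

Definition stable_rank (R : realType) (m n : nat) (A : 'M[R]_(m, n)) : int :=
  Num.floor (hs_norm A ^+ 2 / op_norm A ^+ 2).

(* For a measurable [Z] this supremum is attained, so it is the maximum over
   [u].  A real random variable is treated as the case [k = 1]. *)
Definition concentration (d : measure_display) (T : measurableType d)
    (R : realType) (P : probability T R) (k : nat) (Z : T -> 'cV[R]_k)
    (t : R) : \bar R :=
  ereal_sup [set P [set w | l2_norm (Z w - u) <= t] | u in [set: 'cV[R]_k]].

Definition mutually_independent (d : measure_display) (T : measurableType d)
    (R : realType) (P : probability T R) (n : nat)
    (X : 'I_n -> {RV P >-> R}) : Prop :=
  forall (J : {set 'I_n}) (B : 'I_n -> set R),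
    (forall i, measurable (B i)) ->
    (P (\bigcap_(i in [set` J]) (X i @^-1` B i)) =
     \prod_(i in J) P (X i @^-1` B i))%E.

Definition random_vector (d : measure_display) (T : measurableType d)
    (R : realType) (P : probability T R) (n : nat)
    (X : 'I_n -> {RV P >-> R}) (w : T) : 'cV[R]_n :=
  \col_(i < n) X i w.

(* Main.v *)
Require Import Defs.
From HB Require Import structures.
From mathcomp Require Import all_boot all_order all_algebra.
From mathcomp Require Import all_classical all_reals all_analysis.
From mathcomp Require Import perm complex ring lra.

Set Implicit Arguments.
Unset Strict Implicit.
Unset Printing Implicit Defensive.

Import Order.TTheory GRing.Theory Num.Theory.
Import numFieldNormedType.Exports.

Local Open Scope ring_scope.

(** Let [M = A^T A].  After scaling to [t = 1] and operator norm [1], and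
    discretising the [X_i], the small ball probability is at most
    [exp (2 tr M)] times [E exp (- |A X - u|^2 / 2)], and it is enough to bound
    this expectation by [(C p) ^ tr M], because [tr M] is the unrounded stable
    rank.

    A coordinate with [M_ii > 1/2] is integrated out directly: it costs a factor
    [C p], and projecting [A] away from the [i]-th column lowers [tr M] by at
    most [1].

    If all [M_ii <= 1/2], write the Gaussian kernel as a limit of averages of
    characters [exp (i <g, .>)], so that the expectation is at most the average
    of [prod_i |phi_i (Y_i)|] with [Y = A^T g].  Let [w] be the determinantal
    probability on subsets of [{1..n}] with kernel [M], whose marginals are
    [M_ii].  Hoelder's inequality with the weights [w_S] reduces the product over
    all [i] to the products of [|phi_i| ^ (1 / M_ii)] over [i] in [S].  For each
    [S] the average is computed by going back to the variables: up to dilations,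
    a power of [|phi_i|^2] is dominated by the characteristic function of
    [X_i - X_i'], and eliminating one coordinate after the other gives
    [prod_(i in S) (C p sqrt M_ii) / sqrt (det M_S)].  Finally [w_S <= det M_S],
    and subadditivity of entropy, [H (w) <= - sum_i M_ii ln M_ii + tr M],
    recombines these bounds into [(C p) ^ tr M]. *)

(** * Mixed determinants *)

Section MixedRows.
Variables (R : comNzRingType) (n : nat).
Implicit Types (M N : 'M[R]_n) (S T : {set 'I_n}) (i : 'I_n).

(* [\det (mix_rows S M 1%:M)] is the principal minor of [M] on [S]. *)
Definition mix_rows S M N : 'M[R]_n :=
  \matrix_(i, j) (if i \in S then M i j else N i j).

(** Multilinearity in the rows: each row of [M + N] outside [T] contributes [M] or [N], and [S]
    records where [M] is chosen. *)
Lemma sum_det_mix_rows T M N :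
  \sum_(S : {set 'I_n} | T \subset S) \det (mix_rows S M N) =
  \det (mix_rows T M (M + N)).
Proof.
rewrite /determinant exchange_big /=; apply: eq_bigr => s _.
rewrite -big_distrr /=; congr (_ * _).
have -> : \prod_i mix_rows T M (M + N) i (s i) =
    \prod_i (M i (s i) + (if i \in T then 0 else N i (s i))).
  by apply: eq_bigr => i _; rewrite !mxE; case: ifP => _; rewrite ?addr0.
rewrite bigA_distr /= big_mkcond /=; apply: eq_bigr => S _.
case: ifPn => [/fintype.subsetP TS|].
  apply: eq_bigr => i _; rewrite !mxE; case: ifPn => // iS.
  by case: ifPn => // /TS; rewrite (negbTE iS).
case/fintype.subsetPn => i iT iS.
by rewrite (bigD1 i) //= (negbTE iS) iT mul0r.
Qed.

Lemma det_row1 i (r : 'I_n -> R) :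
  \det (\matrix_(k, l) (if k == i then r l else (k == l)%:R)) = r i.
Proof.
rewrite (expand_det_col _ i) (bigD1 i) //= big1 ?addr0 => [|j ji]; last first.
  by rewrite mxE (negbTE ji) mul0r.
rewrite mxE eqxx /cofactor -signr_odd addnn odd_double expr0 mul1r.
rewrite (_ : row' _ _ = 1%:M) ?det1 ?mulr1//.
apply/matrixP => k l; rewrite !mxE.
by rewrite eq_sym (negbTE (neq_lift _ _)) (inj_eq lift_inj).
Qed.

Lemma det_mix_rows1 i M : \det (mix_rows [set i]%SET M 1%:M) = M i i.
Proof.
rewrite -(det_row1 i (fun l => M i l)); congr (\det _).
by apply/matrixP => k l; rewrite !mxE finset.in_set1; case: eqP => [->|].
Qed.

Lemma det_mix_rows0 M N : \det (mix_rows finset.set0 M N) = \det N.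
Proof. by congr (\det _); apply/matrixP => k l; rewrite !mxE finset.in_set0. Qed.

End MixedRows.

Section SchurDet.
Variables (F : fieldType) (n : nat).
Implicit Types (M : 'M[F]_n) (S : {set 'I_n}) (i : 'I_n).

Definition schur M i : 'M[F]_n := \matrix_(j, k) (M j k - M j i * M i k / M i i).

(** One step of Gaussian elimination with pivot [M i i]. *)
Lemma det_mix_rows_schur S M i : i \in S -> M i i != 0 ->
  \det (mix_rows S M 1%:M) =
  M i i * \det (mix_rows (S :\ i) (schur M i) 1%:M).
Proof.
move=> iS Mi.
(* [C] is the identity with the pivot row inserted, [B] the identity with the pivot column divided
   by the pivot; their determinants are [M i i] and [1]. *)
pose C : 'M[F]_n := \matrix_(k, l) (if k == i then M i l else (k == l)%:R).
pose c j := if j == i then 1 else if j \in S then M j i / M i i else 0.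
pose B : 'M[F]_n := (\matrix_(k, l) (if k == i then c l else (k == l)%:R))^T.
have -> : mix_rows S M 1%:M = B *m (mix_rows (S :\ i) (schur M i) 1%:M *m C).
  have E j k : (mix_rows (S :\ i) (schur M i) 1%:M *m C) j k =
     if j == i then M i k else mix_rows (S :\ i) (schur M i) 1%:M j k.
    rewrite !mxE finset.in_setD1; case: (eqVneq j i) => [->|ji] /=.
      rewrite (bigD1 i) //= big1 => [|l li].
        by rewrite !mxE !eqxx /= finset.in_setD1 eqxx /= mul1r addr0.
      by rewrite !mxE finset.in_setD1 eqxx /= eq_sym (negbTE li) mul0r.
    rewrite (bigD1 i) //= !mxE finset.in_setD1 ji /= (negbTE ji).
    rewrite (_ : (if _ then _ else _) = 0) ?mul0r ?add0r; last first.
      by case: ifP => // _; rewrite mulfK// subrr.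
    have [->|ki] := eqVneq k i.
      rewrite big1 => [|l li]; last by rewrite !mxE (negbTE li) mulr0.
      by case: ifP => // _; rewrite ?mulfK// ?subrr ?(negbTE ji).
    rewrite (bigD1 k) //= big1 ?addr0 => [|l /andP[li lk]]; last first.
      by rewrite !mxE (negbTE li) (negbTE lk) mulr0.
    rewrite !mxE (negbTE ki) eqxx mulr1.
    by rewrite finset.in_setD1 ji.
  apply/matrixP => j k; rewrite [RHS]mxE (bigD1 i) //= E eqxx !mxE eqxx /c.
  have [->|ji] := eqVneq j i.
    rewrite iS mul1r big1 ?addr0// => l li.
    by rewrite !mxE (negbTE li) mul0r.
  rewrite (bigD1 j) //= big1 ?addr0 => [|l /andP[li lj]]; last first.
    by rewrite !mxE (negbTE li) (negbTE lj) mul0r.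
  rewrite E (negbTE ji) !mxE (negbTE ji) eqxx mul1r finset.in_setD1 ji /=.
  by case: ifP => // _; rewrite ?mul0r ?add0r// mulrAC addrC subrK.
rewrite !det_mulmx det_tr !det_row1 /c eqxx mul1r mulrC; congr (_ * _).
Qed.

End SchurDet.

(** * Gram matrices and determinantal weights *)

Section DotProduct.
Variable R : realFieldType.

Definition dotv (k : nat) (u v : 'cV[R]_k) : R := \sum_i u i 0 * v i 0.
Definition nsq (k : nat) (v : 'cV[R]_k) : R := dotv v v.

Lemma dotvC k (u v : 'cV[R]_k) : dotv u v = dotv v u.
Proof. by apply: eq_bigr => i _; rewrite mulrC. Qed.

Lemma dotvDr k (u v w : 'cV[R]_k) : dotv u (v + w) = dotv u v + dotv u w.
Proof. by rewrite -big_split; apply: eq_bigr => i _; rewrite mxE mulrDr. Qed.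

Lemma dotvZr k a (u v : 'cV[R]_k) : dotv u (a *: v) = a * dotv u v.
Proof. by rewrite mulr_sumr; apply: eq_bigr => i _; rewrite mxE mulrCA. Qed.

Lemma dotvBr k (u v w : 'cV[R]_k) : dotv u (v - w) = dotv u v - dotv u w.
Proof. by rewrite -scaleN1r dotvDr dotvZr mulN1r. Qed.

Lemma dotvBl k (u v w : 'cV[R]_k) : dotv (v - w) u = dotv v u - dotv w u.
Proof. by rewrite dotvC dotvBr dotvC (dotvC u). Qed.

Lemma dotvDl k (u v w : 'cV[R]_k) : dotv (v + w) u = dotv v u + dotv w u.
Proof. by rewrite dotvC dotvDr dotvC (dotvC u). Qed.

Lemma dotvZl k a (u v : 'cV[R]_k) : dotv (a *: u) v = a * dotv u v.
Proof. by rewrite dotvC dotvZr dotvC. Qed.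

Lemma dotv_mul k l (A : 'M[R]_(k, l)) u v : dotv u (A *m v) = dotv (A^T *m u) v.
Proof.
rewrite /dotv; under eq_bigr => i _ do rewrite mxE mulr_sumr.
rewrite exchange_big; apply: eq_bigr => j _ /=; rewrite mxE mulr_suml.
by apply: eq_bigr => i _; rewrite mxE mulrA (mulrC (A i j)).
Qed.

Lemma nsqE k (v : 'cV[R]_k) : nsq v = \sum_i v i 0 ^+ 2.
Proof. by apply: eq_bigr => i _; rewrite expr2. Qed.

Lemma nsq_ge0 k (v : 'cV[R]_k) : 0 <= nsq v.
Proof. by rewrite nsqE sumr_ge0// => i _; rewrite sqr_ge0. Qed.

Lemma nsq_eq0 k (v : 'cV[R]_k) : nsq v = 0 -> v = 0.
Proof.
rewrite nsqE => /eqP; rewrite psumr_eq0; last by move=> i _; rewrite sqr_ge0.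
move=> /allP v0; apply/colP => i; rewrite mxE.
by have := v0 i (mem_index_enum _); rewrite sqrf_eq0 => /eqP.
Qed.

Lemma nsqZ k a (v : 'cV[R]_k) : nsq (a *: v) = a ^+ 2 * nsq v.
Proof. by rewrite /nsq dotvZl dotvZr mulrA. Qed.

Lemma nsqB k (u v : 'cV[R]_k) : nsq (u - v) = nsq u - 2 * dotv u v + nsq v.
Proof. by rewrite /nsq dotvBr !dotvBl (dotvC v u); ring. Qed.

Definition sub_identity n (M : 'M[R]_n) :=
  [/\ M^T = M, forall x, 0 <= dotv x (M *m x) & forall x, dotv x (M *m x) <= nsq x].

(* A null vector [x] of the mixed matrix satisfies [<x, M x> = <M x, M x>]. *)
Lemma det_mix_rows_neq0 n (M : 'M[R]_n) S (c e : R) : M^T = M ->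
  0 < e -> c < 1 ->
  (forall x, e * nsq x <= dotv x (M *m x)) ->
  (forall x, dotv x (M *m x) <= c * nsq x) ->
  \det (mix_rows S M (1%:M - M)) != 0.
Proof.
move=> symM e0 c1 Mge Mle; rewrite -det_tr; apply/det0P => -[v vN0 vN].
pose x := v^T.
have Nx : mix_rows S M (1%:M - M) *m x = 0.
  by apply: trmx_inj; rewrite trmx_mul trmxK vN trmx0.
pose y := M *m x.
have xy i : x i 0 * y i 0 = y i 0 ^+ 2.
  have Ni : \sum_j mix_rows S M (1%:M - M) i j * x j 0 = 0.
    by move/matrixP : Nx => /(_ i 0); rewrite mxE => ->; rewrite mxE.
  have [iS|iS] := boolP (i \in S).
    have -> : y i 0 = 0.
      by rewrite mxE -[RHS]Ni; apply: eq_bigr => j _; rewrite !mxE iS.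
    by rewrite mulr0 expr2 mulr0.
  suff -> : y i 0 = x i 0 by rewrite expr2.
  apply/esym/eqP; rewrite -subr_eq0 -[X in _ == X]Ni; apply/eqP.
  have -> : x i 0 - y i 0 = ((1%:M - M) *m x) i 0.
    by rewrite mulmxBl mul1mx /y !mxE.
  by rewrite mxE; apply: eq_bigr => j _; rewrite !mxE (negbTE iS).
have xyE : dotv x y = nsq y by rewrite nsqE; apply: eq_bigr.
have y0 : nsq y = 0.
  apply/eqP; rewrite eq_le nsq_ge0 andbT.
  (* The form at [x - y] is nonnegative and at most [(c - 1) |y|^2] with [c < 1], which forces
     [y = 0]. *)
  have F : dotv (x - y) (M *m (x - y)) = dotv y (M *m y) - nsq y.
    rewrite mulmxBr -/y dotvBr !dotvBl xyE.
    have -> : dotv x (M *m y) = nsq y by rewrite dotv_mul symM.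
    by rewrite /nsq; ring.
  have h1 := Mge (x - y); rewrite F in h1.
  have h2 : 0 <= e * nsq (x - y) by rewrite mulr_ge0 ?nsq_ge0// ltW.
  have h3 := Mle y; have h4 : 0 <= (1 - c) * nsq y by rewrite mulr_ge0 ?nsq_ge0// subr_ge0 ltW.
  rewrite -(@ler_pM2l _ (1 - c)) ?subr_gt0// mulr0; lra.
have := Mge x; rewrite -/y xyE y0 pmulr_rle0// => x0.
have /nsq_eq0 : nsq x = 0 by apply/eqP; rewrite eq_le x0 nsq_ge0.
by move=> /(congr1 trmx); rewrite trmxK trmx0; apply/eqP.
Qed.

End DotProduct.

Section Determinantal.
Variable R : rcfType.

(** Along the segment from [M] to half the identity the spectrum lies strictly inside [(0, 1)] for
    [0 < t <= 1], so the determinant does not vanish there. It is positive at [t = 1]; a negative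
    value at [t = 0] would force a root in between. *)
Lemma det_mix_rows_ge0 n (M : 'M[R]_n) S : sub_identity M ->
  0 <= \det (mix_rows S M (1%:M - M)).
Proof.
move=> [symM Mge0 Mle1].
pose A := mix_rows S M (1%:M - M).
(* [1 - H = H], so rows taken from [M] and rows taken from [1 - M] move towards the same matrix. *)
pose H : 'M[R]_n := (2^-1)%:M.
pose p : {poly R} := \det (map_mx polyC A + 'X *: map_mx polyC (H - A)).
have pE t : p.[t] = \det (A + t *: (H - A)).
  rewrite -[LHS]/(horner_eval t p) /p -det_map_mx; congr (\det _).
  by apply/matrixP => i j; rewrite !mxE -[LHS]/(horner_eval _ _) /horner_eval !hornerE.
have p_neq0 t : 0 < t <= 1 -> p.[t] != 0.
  move=> /andP[t0 t1]; rewrite pE.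
  pose N := (1 - t) *: M + t *: H.
  have -> : A + t *: (H - A) = mix_rows S N (1%:M - N).
    by apply/matrixP => i j; rewrite !mxE; case: ifP => _;
      case: eqP => _; rewrite ?mulr1n ?mulr0n; field.
  have NE x : dotv x (N *m x) = (1 - t) * dotv x (M *m x) + t / 2 * nsq x.
    rewrite mulmxDl -!scalemxAl dotvDr !dotvZr mul_scalar_mx dotvZr /nsq.
    by rewrite mulrA.
  apply: (@det_mix_rows_neq0 _ _ _ _ (1 - t / 2) (t / 2)).
  - by apply/matrixP => i j; rewrite !mxE eq_sym -{1}symM mxE.
  - by rewrite divr_gt0.
  - by rewrite gtrBl divr_gt0.
  - move=> x; rewrite NE lerDr mulr_ge0// subr_ge0//.
  - move=> x; rewrite NE; have := Mle1 x; have := Mge0 x; have := nsq_ge0 x.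
    nra.
have p1 : 0 < p.[1].
  by rewrite pE scale1r addrC subrK det_scalar exprn_gt0// invr_gt0.
have -> : \det A = p.[0] by rewrite pE scale0r addr0.
rewrite leNgt; apply/negP => p0.
have [||x /andP[x0 x1] /rootP px] := @poly_ivt R p 0 1.
- exact: ler01.
- by rewrite !ltW.
have x0' : 0 < x.
  rewrite lt_neqAle x0 andbT; apply: contraTneq p0 => x0e.
  by rewrite -leNgt [in leRHS]x0e px.
by have := p_neq0 x; rewrite x0' x1 px eqxx => /(_ isT).
Qed.

Variables (n : nat) (M : 'M[R]_n).
Hypothesis M_sub1 : sub_identity M.

(* The probability that the determinantal process with kernel [M] equals [S]. *)
Definition dpp (S : {set 'I_n}) : R := \det (mix_rows S M (1%:M - M)).

Lemma dpp_ge0 S : 0 <= dpp S. Proof. exact: det_mix_rows_ge0. Qed.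

Lemma sum_dpp_sup (T : {set 'I_n}) :
  \sum_(S : {set 'I_n} | T \subset S) dpp S = \det (mix_rows T M 1%:M).
Proof. by rewrite sum_det_mix_rows addrC subrK. Qed.

Lemma sum_dpp : \sum_S dpp S = 1.
Proof.
rewrite -[RHS](@det1 _ n) -(det_mix_rows0 M 1%:M) -sum_dpp_sup.
by apply: eq_bigl => S; rewrite finset.sub0set.
Qed.

Lemma dpp_marginal i : \sum_(S : {set 'I_n} | i \in S) dpp S = M i i.
Proof.
rewrite -det_mix_rows1 -sum_dpp_sup.
by apply: eq_bigl => S; rewrite finset.sub1set.
Qed.

(** Being equal to [S] implies containing [S], and the minor on [S] is the probability of the
    latter. *)
Lemma dpp_le S : dpp S <= \det (mix_rows S M 1%:M).
Proof.
rewrite -sum_dpp_sup (bigD1 S) //= lerDl sumr_ge0// => T _; exact: dpp_ge0.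
Qed.

End Determinantal.

Section Gram.
Variables (R : realFieldType) (m n : nat).
Implicit Types (B : 'M[R]_(m, n)) (b v : 'cV[R]_m) (i : 'I_n).

Definition gram B : 'M[R]_n := B^T *m B.
Definition contraction B := forall x, nsq (B *m x) <= nsq x.
(** Orthogonal projection onto the complement of [b]; since [0^-1 = 0], it is the identity when
    [b = 0]. *)
Definition proj b : 'M[R]_m := 1%:M - (nsq b)^-1 *: (b *m b^T).
Definition deflate B i : 'M[R]_(m, n) := proj (col i B) *m B.

Lemma gram_dot B j k : gram B j k = dotv (col j B) (col k B).
Proof. by rewrite mxE; apply: eq_bigr => l _; rewrite !mxE. Qed.

Lemma gram_diag B i : gram B i i = nsq (col i B).
Proof. exact: gram_dot. Qed.

Lemma gram_sub_identity B : contraction B -> sub_identity (gram B).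
Proof.
have E x : dotv x (gram B *m x) = nsq (B *m x).
  by rewrite -mulmxA dotv_mul trmxK.
move=> cB; split=> [|x|x]; rewrite ?E ?nsq_ge0//.
by rewrite trmx_mul trmxK.
Qed.

Lemma gram_diag_le1 B i : contraction B -> gram B i i <= 1.
Proof.
move=> /(_ (delta_mx i 0)); rewrite -colE -gram_diag => /le_trans; apply.
rewrite nsqE (bigD1 i) //= !mxE !eqxx expr1n big1 ?addr0// => j ji.
by rewrite mxE (negbTE ji) expr0n.
Qed.

Lemma projE b v : proj b *m v = v - (dotv b v / nsq b) *: b.
Proof.
rewrite mulmxBl mul1mx -scalemxAl -mulmxA.
have -> : b^T *m v = (dotv b v)%:M.
  apply/matrixP => j k; rewrite !ord1 !mxE mulr1n.
  by apply: eq_bigr => l _; rewrite !mxE.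
by rewrite mul_mx_scalar scalerA mulrC.
Qed.

Lemma nsq_proj b v : nsq b != 0 ->
  nsq v = dotv b v ^+ 2 / nsq b + nsq (proj b *m v).
Proof.
move=> b0; rewrite projE nsqB nsqZ dotvZr (dotvC v).
by field.
Qed.

(** Removing the component along column [i] is a Gram-Schmidt step, which acts on inner products as
    a Schur complement. This links [deflate] to [det_mix_rows_schur]. *)
Lemma gram_deflate B i : nsq (col i B) != 0 ->
  gram (deflate B i) = schur (gram B) i.
Proof.
move=> b0; apply/matrixP => j k; rewrite [RHS]mxE !gram_dot.
have E l : col l (deflate B i) = col l B - (dotv (col i B) (col l B) / nsq (col i B)) *: col i B.
  by rewrite -projE colE -mulmxA -colE.
rewrite !E !dotvBr !dotvBl !dotvZl !dotvZr -!/(nsq _) (dotvC _ (col i B)).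
by field.
Qed.

Lemma contraction_deflate B i : nsq (col i B) != 0 -> contraction B ->
  contraction (deflate B i).
Proof.
move=> b0 cB x; apply: le_trans (cB x).
rewrite (nsq_proj (B *m x) b0) mulmxA lerDr mulr_ge0 ?sqr_ge0//.
by rewrite invr_ge0 nsq_ge0.
Qed.

(** The trace drops by [|B^T b|^2 / |b|^2] with [b] the [i]-th column, and the transpose of a
    contraction is a contraction. *)
Lemma mxtrace_deflate B i : nsq (col i B) != 0 -> contraction B ->
  \tr (gram B) <= 1 + \tr (gram (deflate B i)).
Proof.
move=> b0 cB; rewrite gram_deflate// /mxtrace.
under [X in 1 + X]eq_bigr => j _ do rewrite mxE.
rewrite sumrB addrCA lerDl subr_ge0.
set b := col i B in b0 *.
have b_gt0 : 0 < nsq b by rewrite lt_neqAle eq_sym b0 nsq_ge0.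
have -> : \sum_j gram B j i * gram B i j / gram B i i = nsq (B^T *m b) / nsq b.
  rewrite gram_diag -mulr_suml; congr (_ / _); rewrite nsqE; apply: eq_bigr => j _.
  have -> : (B^T *m b) j 0 = gram B j i.
    by rewrite !mxE; apply: eq_bigr => l _; rewrite !mxE.
  by rewrite expr2; congr (_ * _); rewrite !gram_dot dotvC.
rewrite ler_pdivrMr// mul1r.
(* [0 <= |b - B z|^2] and [<b, B z> = |z|^2] give [2 |z|^2 <= |b|^2 + |B z|^2 <= |b|^2 + |z|^2]. *)
set z := B^T *m b.
have := nsq_ge0 (b - B *m z); rewrite nsqB dotv_mul -/z -/(nsq z).
have := cB z; lra.
Qed.

Lemma col_deflate B i : nsq (col i B) != 0 -> col i (deflate B i) = 0.
Proof.
move=> b0; apply: nsq_eq0; rewrite -gram_diag gram_deflate// mxE.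
by rewrite gram_diag mulfK// subrr.
Qed.

Lemma gram_deflate_diag_le B i j : nsq (col i B) != 0 ->
  gram (deflate B i) j j <= gram B j j.
Proof.
move=> b0; rewrite gram_deflate// mxE lerBlDr lerDl.
have -> : gram B i j = gram B j i by rewrite !gram_dot dotvC.
by rewrite -expr2 mulr_ge0 ?sqr_ge0// invr_ge0 gram_diag nsq_ge0.
Qed.

End Gram.

(** * Entropy and elementary inequalities *)

Section Entropy.
Variable R : realType.

(** The tangent of [expR] at the mean [G] lies below the graph, and averaging kills its linear
    term. *)
Lemma jensen_expR (I : finType) (w g : I -> R) :
  (forall i, 0 <= w i) -> \sum_i w i = 1 ->
  expR (\sum_i w i * g i) <= \sum_i w i * expR (g i).
Proof.
move=> w0 w1; set G := \sum_i w i * g i.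
have -> : expR G = \sum_i w i * (expR G * (1 + (g i - G))).
  under eq_bigr => i _ do rewrite mulrCA.
  rewrite -mulr_sumr -[LHS]mulr1; congr (_ * _).
  under eq_bigr => i _ do rewrite mulrDr mulr1 mulrBr.
  by rewrite big_split /= sumrB -mulr_suml w1 -/G mul1r subrr addr0.
apply: ler_sum => i _; rewrite ler_wpM2l//.
rewrite -[in leRHS](subrKC G (g i)) expRD ler_wpM2l ?expR_ge0//.
exact: expR_ge1Dx.
Qed.

Variables (n : nat) (w : {set 'I_n} -> R) (m : 'I_n -> R).
Hypothesis w_ge0 : forall S, 0 <= w S.
Hypothesis w_sum : \sum_S w S = 1.
Hypothesis marg : forall i, \sum_(S : {set 'I_n} | i \in S) w S = m i.

Lemma sum_marginal (f : 'I_n -> R) :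
  \sum_S w S * (\sum_(i in S) f i) = \sum_i m i * f i.
Proof.
under eq_bigr => S _ do rewrite mulr_sumr.
rewrite (exchange_big_dep xpredT) //=; apply: eq_bigr => i _.
by rewrite -mulr_suml marg.
Qed.

Lemma marginal_gt0 (S : {set 'I_n}) i : i \in S -> 0 < w S -> 0 < m i.
Proof.
move=> iS wS; rewrite -marg (bigD1 S) //= ltr_pwDl// sumr_ge0//.
Qed.

(* Gibbs' inequality against the product weights [\prod_(i in S) m i], whose
   total mass is at most [expR (\sum_i m i)]. *)
Lemma entropy_le_marginals :
  - (\sum_S w S * ln (w S)) <= - (\sum_i m i * ln (m i)) + \sum_i m i.
Proof.
have m_ge0 i : 0 <= m i by rewrite -marg sumr_ge0.
set d := \sum_i m i.
pose q (S : {set 'I_n}) := \prod_(i in S) m i.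
have q_ge0 S : 0 <= q S by apply: prodr_ge0.
have q_sum : \sum_S q S <= expR d.
  have -> : \sum_S q S = \prod_i (m i + 1).
    rewrite bigA_distr; apply: eq_bigr => S _.
    by rewrite [RHS]big_mkcond /= /q big_mkcond.
  rewrite expR_sum; apply: ler_prod => i _; rewrite addr_ge0//= addrC.
  exact: expR_ge1Dx.
(* This is [1 + y <= expR y] at [y = ln (q S) - ln (w S) - d], multiplied by [w S]. *)
have H (S : {set 'I_n}) : w S * \sum_(i in S) ln (m i) - w S * ln (w S) <=
    q S * expR (- d) + (d - 1) * w S.
  have [w0|w0] := eqVneq (w S) 0.
    by rewrite w0 !mul0r mulr0 subr0 addr0 mulr_ge0// expR_ge0.
  have wS : 0 < w S by rewrite lt_neqAle eq_sym w0 w_ge0.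
  have mS i : i \in S -> 0 < m i by move=> iS; exact: marginal_gt0 wS.
  have -> : \sum_(i in S) ln (m i) = ln (q S).
    rewrite -[LHS]expRK expR_sum; congr ln; apply: eq_bigr => i iS.
    by rewrite lnK// posrE mS.
  have qS : 0 < q S by apply: prodr_gt0.
  have E : expR (ln (q S) - ln (w S) - d) = q S * expR (- d) / w S.
    rewrite !expRD [in X in _ * X * _]expRN !lnK ?posrE//.
    by rewrite mulrAC.
  have := expR_ge1Dx (ln (q S) - ln (w S) - d); rewrite E.
  rewrite ler_pdivlMr//; lra.
have := ler_sum (index_enum _) (fun S (_ : true) => H S).
rewrite sumrB big_split /= sum_marginal -mulr_suml -mulr_sumr w_sum mulr1.
move=> H1; have H2 : (\sum_S q S) * expR (- d) <= 1.
  by rewrite expRN ler_pdivrMr ?expR_gt0// mul1r.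
lra.
Qed.

End Entropy.

Section Powers.
Variable R : realType.

(** Bernoulli bounds [h x] by [(1 + x) ^ h], and [(1 - x) (1 + x) <= 1]. *)
Lemma exprN_sub1_le (x : R) h : 0 < x <= 1 -> (1 - x) ^+ h * (h%:R * x) <= 1.
Proof.
move=> /andP[x0 x1].
have B k : 1 + k%:R * x <= (1 + x) ^+ k.
  elim: k => [|k IH]; first by rewrite mul0r addr0.
  rewrite exprS; apply: le_trans (ler_wpM2l _ IH); last lra.
  rewrite -natr1; have : 0 <= k%:R * x * x by rewrite !mulr_ge0// ltW.
  nra.
have P : 0 <= (1 - x) ^+ h by rewrite exprn_ge0// subr_ge0.
apply: (@le_trans _ _ ((1 - x) ^+ h * (1 + x) ^+ h)).
  by rewrite ler_wpM2l//; have := B h; lra.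
rewrite -exprMn -subr_sqr expr1n exprn_ile1//; nra.
Qed.

(* Applied to [a j = psi (2 ^ j * y)] for [psi] the squared modulus of a
   characteristic function. *)
Lemma pow4_le_sum_dilates (a : nat -> R) J :
  (forall j, 0 <= a j <= 1) ->
  (forall j, 1 - a j.+1 <= 4 * (1 - a j)) ->
  a 0%N ^+ (4 ^ J) <= \sum_(j < J.+1) 16 * 4 ^- (J - j) * a j.
Proof.
move=> a01 a4.
have a_ge0 j : 0 <= a j by case/andP: (a01 j).
have a_le1 j : a j <= 1 by case/andP: (a01 j).
have key j : (j <= J)%N -> a 0%N ^+ (4 ^ J) <= 16 * 4 ^- (J - j) * a j ->
    a 0%N ^+ (4 ^ J) <= \sum_(j < J.+1) 16 * 4 ^- (J - j) * a j.
  move=> jJ /le_trans; apply; have jJ' : (j < J.+1)%N by [].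
  rewrite (bigD1 (Ordinal jJ')) //= lerDl sumr_ge0// => k _.
  by rewrite !mulr_ge0// invr_ge0 exprn_ge0.
have [aJ|aJ] := leP (2^-1) (a J).
  apply: (key J) => //; rewrite subnn expr0 invr1 mulr1.
  apply: (@le_trans _ _ 1); first exact: exprn_ile1.
  lra.
have exj : exists j, a j < 2^-1 by exists J.
(* Take the first index where [a] is below one half. If it is [0], the power itself is tiny. If it
   is [j.+1], quadrupling gives [1/2 < 4 ^ j.+1 * (1 - a 0)], hence a bound [8 * 4 ^- (J - j)] on
   the power, while [a j >= 1/2]. *)
case: (ex_minnP exj) => -[|j] aj jmin.
  apply: (key 0%N) => //; rewrite subn0.
  have hJ : (0 < 4 ^ J)%N by rewrite expn_gt0.
  rewrite -(prednK hJ) exprSr ler_wpM2r//.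
  apply: (@le_trans _ _ (2^-1 ^+ (4 ^ J).-1)).
    by rewrite lerXn2r ?nnegrE// ltW.
  rewrite exprVn -natrX -[X in X <= _]div1r ler_pdivrMr ?exprn_gt0//.
  have -> : 4 ^+ J = (4 ^ J)%:R :> R by rewrite natrX.
  rewrite mulrAC ler_pdivlMr ?ltr0n// mul1r.
  have : (4 ^ J <= 2 ^ (4 ^ J))%N by rewrite ltnW// ltn_expl.
  rewrite -{2}(prednK hJ) expnS -(ler_nat R) natrM natrX.
  have : 0 <= 2 ^+ (4 ^ J).-1 :> R by rewrite exprn_ge0.
  by rewrite natrX; nra.
have jJ : (j < J)%N by apply: (jmin J).
have aj2 : 2^-1 <= a j.
  by rewrite leNgt; apply/negP => /jmin; rewrite ltnn.
apply: (key j); first exact: ltnW.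
have tau k : 1 - a k <= 4 ^+ k * (1 - a 0%N).
  elim: k => [|k IH]; first by rewrite expr0 mul1r.
  by apply: le_trans (a4 k) _; rewrite exprS -mulrA ler_wpM2l.
have t := tau j.+1; have t0 : 0 < 1 - a 0%N.
  have : 0 < 4 ^+ j.+1 * (1 - a 0%N) by apply: lt_le_trans t; lra.
  by rewrite pmulr_rgt0// exprn_gt0.
have := @exprN_sub1_le (1 - a 0%N) (4 ^ J); rewrite subKr t0 lerBlDr lerDl a_ge0.
move=> /(_ isT); rewrite natrX => H.
apply: (@le_trans _ _ (8 * 4 ^- (J - j))); last first.
  have : 0 <= 4 ^- (J - j) :> R by rewrite invr_ge0 exprn_ge0.
  nra.
rewrite ler_pdivlMr ?exprn_gt0//.
have E : 4 ^+ J = 4 ^+ (J - j) * 4 ^+ j :> R by rewrite -exprD subnK// ltnW.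
rewrite E in H; rewrite exprS in t.
set A := a 0%N ^+ _ in H *; set D := 4 ^+ (J - j) in H *.
have AD : 0 <= A * D by rewrite mulr_ge0 ?exprn_ge0.
have : A * D * (1 - 2^-1) <= A * D * (4 * (4 ^+ j * (1 - a 0%N))).
  rewrite ler_wpM2l//; have := ltW aj; lra.
lra.
Qed.

(** The chosen [4 ^ J * m] lies between [1/8] and [1/2], so [2 * 4 ^ J] replaces the Hoelder
    exponent [1 / m] up to a bounded factor. *)
Lemma exists_pow4_scale (m : R) : 0 < m <= 2^-1 ->
  exists J, 2 * 4 ^+ J * m <= 1 /\ 1 <= 8 * 4 ^+ J * m.
Proof.
move=> /andP[m0 m2].
have exJ : exists J, 1 <= 8 * 4 ^+ J * m.
  have m1 : 0 <= m^-1 by rewrite invr_ge0 ltW.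
  exists (Num.bound m^-1); have := archi_boundP m1.
  set k := Num.bound _ => mk.
  have k4 : k%:R <= 4 ^+ k :> R by rewrite -natrX ler_nat ltnW// ltn_expl.
  have : m^-1 * m <= 4 ^+ k * m by rewrite ler_wpM2r ?ltW//; lra.
  rewrite mulVf ?gt_eqF//; lra.
case: (ex_minnP exJ) => -[|J] HJ Jmin; first by exists 0%N; rewrite expr0; lra.
exists J.+1; split=> //.
have : ~~ (1 <= 8 * 4 ^+ J * m) by apply/negP => /Jmin; rewrite ltnn.
rewrite -ltNge exprS; lra.
Qed.

End Powers.

(** * Gaussian smoothing *)

Section GaussianSmoothing.
Variable R : realType.

Lemma expR_half_le2 : expR (2^-1) <= 2 :> R.
Proof.
have e0 := expR_gt0 (2^-1 : R).
have := expR_ge1Dx (- 2^-1 : R); rewrite expRN -[in leRHS]div1r ler_pdivlMr//; lra.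
Qed.

Lemma gauss_le_expRN (z : R) : expR (- (z ^+ 2 / 2)) <= 2 * expR (- `|z|).
Proof.
have h := expR_half_le2.
apply: (@le_trans _ _ (expR (2^-1) * expR (- `|z|))); last first.
  by rewrite ler_wpM2r ?expR_ge0.
rewrite -expRD ler_expR; have := sqr_ge0 (`|z| - 1); rewrite -(real_normK (num_real z)); lra.
Qed.

Lemma geometric_expRN_le (s : R) N : 0 < s <= 1 ->
  \sum_(l < N) expR (- s) ^+ l <= 2 / s.
Proof.
move=> /andP[s0 s1]; set r := expR (- s).
have r1 : r * (1 + s) <= 1.
  rewrite /r expRN mulrC ler_pdivrMr ?expR_gt0// mul1r; exact: expR_ge1Dx.
have r0 : 0 < r by exact: expR_gt0.
have rs : s / 2 <= 1 - r by nra.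
rewrite ler_pdivlMr//.
have := subrX1 r N; have : 0 <= r ^+ N by rewrite exprn_ge0// ltW.
set G := \sum_(l < N) _; have G0 : 0 <= G by rewrite sumr_ge0// => i _; rewrite exprn_ge0// ltW.
move=> rN E; have : G * (s / 2) <= G * (1 - r) by rewrite ler_wpM2l.
nra.
Qed.

Variables (K : finType) (w x : K -> R) (p : R).
Hypothesis w_ge0 : forall k, 0 <= w k.
Hypothesis conc : forall a, \sum_(k | `|x k - a| <= 1) w k <= p.

(** Sort the points by the integer part [l] of their distance to [a]. Each shell is covered by two
    unit intervals centred at [a + l] and [a - l], of mass at most [p] each, and the kernel decays
    geometrically with ratio [expR (- s)] over the shells. *)
Lemma gauss_smoothing_le (mu a : R) : 0 < mu <= 1 ->
  \sum_k w k * expR (- (mu / 2 * (x k - a) ^+ 2)) <= 8 * p / Num.sqrt mu.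
Proof.
move=> /andP[mu0 mu1]; set s := Num.sqrt mu.
have s0 : 0 < s by rewrite sqrtr_gt0.
have s1 : s <= 1 by rewrite -sqrtr1 ler_wsqrtr.
have ss : s ^+ 2 = mu by rewrite sqr_sqrtr// ltW.
pose l k := Num.truncn `|x k - a|.
pose N := (\max_k l k).+1.
have lN k : (l k < N)%N by rewrite ltnS leq_bigmax.
have lE k : (l k)%:R <= `|x k - a| < (l k).+1%:R by exact: truncn_itv.
apply: (@le_trans _ _ (\sum_k w k * (2 * expR (- s) ^+ l k))).
  apply: ler_sum => k _; rewrite ler_wpM2l//.
  have -> : mu / 2 * (x k - a) ^+ 2 = (s * (x k - a)) ^+ 2 / 2.
    by rewrite exprMn ss; field.
  apply: le_trans (gauss_le_expRN _) _; rewrite ler_pM2l//.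
  rewrite -expRM_natl ler_expR mulrN lerN2 mulrC normrM (gtr0_norm s0).
  by rewrite ler_pM2l//; case/andP: (lE k).
rewrite (partition_big (fun k => Ordinal (lN k)) xpredT)//=.
apply: (@le_trans _ _ (\sum_(j < N) (2 * p) * (2 * expR (- s) ^+ j))).
  apply: ler_sum => j _.
  under eq_bigr => k /eqP kj do rewrite -[l k]/(val (Ordinal (lN k))) kj.
  rewrite -mulr_suml ler_wpM2r ?mulr_ge0 ?exprn_ge0 ?expR_ge0//.
  have c1 := conc (a + j%:R); have c2 := conc (a - j%:R).
  apply: le_trans (_ : \sum_(k | `|x k - (a + j%:R)| <= 1) w k +
     \sum_(k | `|x k - (a - j%:R)| <= 1) w k <= _); last lra.
  rewrite big_mkcond [in leRHS]big_mkcond [X in _ + X]big_mkcond -big_split /=.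
  apply: ler_sum => k _; case: eqP => [jE|_]; last first.
    by rewrite addr_ge0//; case: ifP.
  have := lE k; rewrite -[l k]/(val (Ordinal (lN k))) jE -natr1.
  move=> /andP[h1 h2].
  have [d0|d0] := lerP 0 (x k - a).
    rewrite ger0_norm// in h1 h2.
    rewrite (_ : `|x k - (a + j%:R)| <= 1); last by rewrite ler_norml; lra.
    by rewrite lerDl; case: ifP.
  rewrite ltr0_norm// in h1 h2.
  rewrite (_ : `|x k - (a - j%:R)| <= 1); last by rewrite ler_norml; lra.
  by rewrite lerDr; case: ifP.
rewrite -!mulr_sumr.
have p0 : 0 <= p by apply: le_trans (conc 0); rewrite sumr_ge0.
have := @geometric_expRN_le s N; rewrite s0 s1 => /(_ isT) g.
have -> : 8 * p / s = 2 * p * (2 * (2 / s)) by field; rewrite gt_eqF.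
by rewrite ler_wpM2l ?mulr_ge0// ler_pM2l.
Qed.

End GaussianSmoothing.

(** * Product laws and elimination of coordinates *)

Section ProductLaw.
Variables (R : realType) (n : nat) (K : finType) (w : 'I_n -> K -> R).
Hypothesis w_ge0 : forall i k, 0 <= w i k.
Hypothesis w_sum : forall i, \sum_k w i k = 1.
Implicit Types (k : {ffun 'I_n -> K}) (f g : {ffun 'I_n -> K} -> R).

Definition mean f : R := \sum_(k : {ffun 'I_n -> K}) (\prod_i w i (k i)) * f k.

Definition upd k i c : {ffun 'I_n -> K} := [ffun j => if j == i then c else k j].

Lemma mean1 : mean (fun=> 1) = 1.
Proof.
rewrite /mean; under eq_bigr do rewrite mulr1.
by rewrite -(bigA_distr_bigA w) big1.
Qed.

Lemma ler_mean f g : (forall k, f k <= g k) -> mean f <= mean g.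
Proof. by move=> fg; apply: ler_sum => k _; rewrite ler_wpM2l ?prodr_ge0. Qed.

Lemma meanZ c f : mean (fun k => c * f k) = c * mean f.
Proof. by rewrite mulr_sumr; apply: eq_bigr => k _; rewrite mulrCA. Qed.

Lemma mean_resample i f :
  mean f = mean (fun k => \sum_c w i c * f (upd k i c)).
Proof.
transitivity (\sum_(k : {ffun 'I_n -> K}) \sum_c (\prod_j w j (k j)) * w i c * f k).
  apply: eq_bigr => k _; rewrite -mulr_suml -mulr_sumr w_sum mulr1//.
rewrite pair_big /=.
(* Exchanging the coordinate [k i] with the fresh value [c] is an involution. *)
rewrite (reindex_inj (h := fun u => (upd u.1 i u.2, u.1 i))) /=; last first.
  apply: (can_inj (g := fun u => (upd u.1 i u.2, u.1 i))) => -[k c] /=.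
  rewrite ffunE eqxx; congr pair; apply/ffunP => j; rewrite !ffunE.
  by case: eqP => // ->.
rewrite -(pair_big xpredT xpredT (fun k c =>
  (\prod_j w j (upd k i c j)) * w i (k i) * f (upd k i c))) /=.
apply: eq_bigr => k _; rewrite mulr_sumr; apply: eq_bigr => c _.
rewrite mulrA; congr (_ * _).
rewrite (bigD1 i) //= [in RHS](bigD1 i) //= ffunE eqxx.
have -> : \prod_(j | j != i) w j (upd k i c j) = \prod_(j | j != i) w j (k j).
  by apply: eq_bigr => j ji; rewrite ffunE (negbTE ji).
by rewrite mulrAC [RHS]mulrAC (mulrC (w i c)).
Qed.

Lemma mean_step i c f g : 
  (forall k, \sum_b w i b * f (upd k i b) <= c * g k) ->
  mean f <= c * mean g.
Proof. by move=> fg; rewrite (mean_resample i) -meanZ; exact: ler_mean. Qed.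

Variable z : 'I_n -> K -> R.

Definition valv k : 'cV[R]_n := \col_i z i (k i).

Definition gk m (v : 'cV[R]_m) : R := expR (- (nsq v / 2)).

Lemma gk_le1 m (v : 'cV[R]_m) : gk v <= 1.
Proof. by rewrite expR_le1 oppr_le0 divr_ge0 ?nsq_ge0. Qed.

(** By Pythagoras the kernel splits into a one-dimensional Gaussian along the [i]-th column and a
    kernel of the projected vector, which does not involve coordinate [i]. *)
Lemma mean_gk_step m (B : 'M[R]_(m, n)) u i c : nsq (col i B) != 0 ->
  (forall a, \sum_b w i b * expR (- (nsq (col i B) / 2 * (z i b - a) ^+ 2)) <= c) ->
  mean (fun k => gk (B *m valv k - u)) <=
  c * mean (fun k => gk (deflate B i *m valv k - proj (col i B) *m u)).
Proof.
move=> b0 H; apply: (mean_step (i := i)) => k.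
set b := col i B in b0 H *; set v0 := B *m valv k - u.
(* The value of coordinate [i] at which the component along [b] vanishes. *)
pose a := z i (k i) - dotv b v0 / nsq b.
have E c' : gk (B *m valv (upd k i c') - u) =
    expR (- (nsq b / 2 * (z i c' - a) ^+ 2)) * gk (proj b *m v0).
  pose t := z i c' - z i (k i).
  have -> : valv (upd k i c') = valv k + t *: delta_mx i 0.
    apply/colP => j; rewrite !mxE ffunE eqxx andbT.
    by case: eqP => [->|_]; rewrite ?mulr1 ?mulr0 ?addr0// /t addrC subrK.
  have -> : B *m (valv k + t *: delta_mx i 0) - u = v0 + t *: b.
    by rewrite mulmxDr -scalemxAr -colE addrAC.
  rewrite /gk -expRD (nsq_proj (v0 + t *: b) b0) mulmxDr -scalemxAr.
  have -> : proj b *m b = 0 by rewrite projE -/(nsq b) divff// scale1r subrr.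
  rewrite scaler0 addr0 dotvDr dotvZr -/(nsq b); congr expR.
  by rewrite /a /t; field.
under eq_bigr => c' _ do rewrite E mulrA.
rewrite -mulr_suml /deflate -/b -mulmxA -mulmxBr -/v0.
by rewrite ler_wpM2r ?expR_ge0// H.
Qed.

(** Induction on [#|S|]: integrating out [i] costs [beta i] over the root of the pivot, and the
    pivots multiply to the minor on [S]. The bound is assumed for every [mu <= gram B i i] because
    deflation shrinks the remaining diagonal entries. *)
Lemma mean_gk_det m (S : {set 'I_n}) (B : 'M[R]_(m, n)) u (beta : 'I_n -> R) :
  (forall i, i \in S -> 0 <= beta i) ->
  (forall i mu a, i \in S -> 0 < mu <= gram B i i ->
    Num.sqrt mu * \sum_b w i b * expR (- (mu / 2 * (z i b - a) ^+ 2)) <= beta i) ->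
  mean (fun k => gk (B *m valv k - u)) *
    Num.sqrt (\det (mix_rows S (gram B) 1%:M)) <= \prod_(i in S) beta i.
Proof.
move: {2}#|S| (erefl #|S|) => s; elim: s S B u => [|s IH] S B u.
  move/eqP; rewrite finset.cards_eq0 => /eqP -> _ _.
  rewrite det_mix_rows0 det1 sqrtr1 mulr1 finset.big_set0 -mean1.
  by apply: ler_mean => k; exact: gk_le1.
move=> cS beta0 H.
have [i iS] : exists i, i \in S by apply/set0Pn; rewrite -finset.cards_eq0 cS.
rewrite (finset.big_setD1 i)//=.
(* A zero column in [S] makes the minor vanish. *)
have [b0|b0] := eqVneq (nsq (col i B)) 0.
  have -> : \det (mix_rows S (gram B) 1%:M) = 0.
    rewrite (expand_det_row _ i) big1// => j _; rewrite mxE iS gram_dot.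
    by rewrite (nsq_eq0 b0) /dotv big1 ?mul0r// => l _; rewrite mxE mul0r.
  rewrite sqrtr0 mulr0 mulr_ge0 ?beta0// prodr_ge0// => j.
  by rewrite finset.in_setD1 => /andP[_ jS]; exact: beta0.
have g0 : 0 < gram B i i by rewrite gram_diag lt_neqAle eq_sym b0 nsq_ge0.
rewrite (det_mix_rows_schur iS) ?gt_eqF// -gram_deflate// sqrtrM ?(ltW g0)//.
have sg0 : 0 < Num.sqrt (gram B i i) by rewrite sqrtr_gt0.
have st := @mean_gk_step _ B u i (beta i / Num.sqrt (gram B i i)) b0.
set E' := mean (fun k => gk (deflate B i *m valv k - _)) in st.
have {}st : mean (fun k => gk (B *m valv k - u)) * Num.sqrt (gram B i i) <= beta i * E'.
  rewrite -ler_pdivlMr// mulrAC; apply: st => a.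
  rewrite ler_pdivlMr// mulrC -gram_diag; apply: H => //.
  by rewrite g0 lexx.
rewrite mulrA; apply: le_trans (ler_wpM2r (sqrtr_ge0 _) st) _.
rewrite -mulrA ler_wpM2l ?beta0//; apply: IH.
- by move: cS; rewrite (cardsD1 i) iS => -[].
- by move=> j; rewrite finset.in_setD1 => /andP[_ /beta0].
- move=> j mu a; rewrite finset.in_setD1 => /andP[_ jS] /andP[mu0 muj].
  apply: H => //; rewrite mu0; apply: le_trans muj _.
  exact: gram_deflate_diag_le.
Qed.

End ProductLaw.

(** * Characteristic functions *)

Section Cis.
Variable R : realType.
Local Open Scope complex_scope.
Implicit Types (z : R[i]) (t : R).

Definition cis t : R[i] := cos t +i* sin t.
Definition normsq z : R := complex.Re z ^+ 2 + complex.Im z ^+ 2.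

Lemma cis0 : cis 0 = 1.
Proof. by rewrite /cis cos0 sin0. Qed.

Lemma cisD t u : cis (t + u) = cis t * cis u.
Proof. by rewrite /cis cosD sinD; simpc; congr (_ +i* _); rewrite addrC. Qed.

Lemma cis_sum (I : Type) (r : seq I) (P : pred I) (F : I -> R) :
  cis (\sum_(i <- r | P i) F i) = \prod_(i <- r | P i) cis (F i).
Proof. exact: (big_morph cis cisD cis0). Qed.

Lemma Re_sum (I : Type) (r : seq I) (P : pred I) (F : I -> R[i]) :
  complex.Re (\sum_(i <- r | P i) F i) = \sum_(i <- r | P i) complex.Re (F i).
Proof. by apply: (big_morph (@complex.Re R)) => // -[a b] [c d]. Qed.

Lemma Im_sum (I : Type) (r : seq I) (P : pred I) (F : I -> R[i]) :
  complex.Im (\sum_(i <- r | P i) F i) = \sum_(i <- r | P i) complex.Im (F i).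
Proof. by apply: (big_morph (@complex.Im R)) => // -[a b] [c d]. Qed.

Lemma Re_realM t z : complex.Re (t%:C * z) = t * complex.Re z.
Proof. by case: z => a b; simpc. Qed.

Lemma Im_realM t z : complex.Im (t%:C * z) = t * complex.Im z.
Proof. by case: z => a b; simpc. Qed.

Lemma normsq_ge0 z : 0 <= normsq z.
Proof. by rewrite addr_ge0 ?sqr_ge0. Qed.

Lemma normsqM z1 z2 : normsq (z1 * z2) = normsq z1 * normsq z2.
Proof. by case: z1 z2 => a b [c d]; rewrite /normsq; simpc => /=; ring. Qed.

Lemma normsq_cis t : normsq (cis t) = 1.
Proof. exact: cos2Dsin2. Qed.

Lemma Re_le_normsq z : complex.Re z <= Num.sqrt (normsq z).
Proof.
apply: le_trans (ler_norm _) _; rewrite -sqrtr_sqr ler_wsqrtr// lerDl sqr_ge0//.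
Qed.

Lemma sqrt_normsq_prod n (F : 'I_n -> R[i]) :
  Num.sqrt (normsq (\prod_i F i)) = \prod_i Num.sqrt (normsq (F i)).
Proof.
apply: (big_morph (fun z => Num.sqrt (normsq z))).
  by move=> a b; rewrite normsqM sqrtrM ?normsq_ge0.
by rewrite /normsq /= expr1n expr0n addr0 sqrtr1.
Qed.

End Cis.

Section Rademacher.
Variable R : realType.
Local Open Scope complex_scope.

(** An approximation of [gk v] for large [L] that is a finite average of characters. *)
Definition coskernel (L m : nat) (v : 'cV[R]_m) : R :=
  \prod_j cos (v j 0 / Num.sqrt L%:R) ^+ L.

(* The kernel is the characteristic function of a normalised sum of [L]
   independent uniform sign vectors. *)
Lemma coskernel_charfun (L m : nat) :
  exists (Om : finType) (g : Om -> 'cV[R]_m) (q : R), 0 <= q /\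
    forall v, \sum_om q%:C * cis (dotv (g om) v) = (coskernel L v)%:C.
Proof.
pose sg (b : bool) : R := if b then 1 else -1.
exists {ffun 'I_m * 'I_L -> bool}.
exists (fun om : {ffun 'I_m * 'I_L -> bool} =>
  \col_j \sum_l sg (om (j, l)) / Num.sqrt L%:R).
exists (\prod_(u : 'I_m * 'I_L) 2^-1); split; first by rewrite prodr_ge0.
move=> v.
pose F (u : 'I_m * 'I_L) (b : bool) : R[i] :=
  (2^-1)%:C * cis (sg b * (v u.1 0 / Num.sqrt L%:R)).
have E u : \sum_b F u b = (cos (v u.1 0 / Num.sqrt L%:R))%:C.
  rewrite big_bool -[LHS]/(F u true + F u false) /F /sg mul1r mulN1r /cis cosN sinN; simpc.
  by congr (_ +i* _); field.
transitivity (\sum_(om : {ffun 'I_m * 'I_L -> bool}) \prod_u F u (om u)).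
  apply: eq_bigr => om _; rewrite big_split /= rmorph_prod; congr (_ * _).
  rewrite -cis_sum; congr cis.
  transitivity (\sum_j \sum_l sg (om (j, l)) * (v j 0 / Num.sqrt L%:R)).
    apply: eq_bigr => j _; rewrite mxE mulr_suml; apply: eq_bigr => l _.
    by rewrite -mulrA (mulrC _ (v j 0)).
  by rewrite pair_big; apply: eq_bigr => -[j l].
rewrite -bigA_distr_bigA /= (eq_bigr _ (fun u _ => E u)) -rmorph_prod; congr (_ %:C).
rewrite -(pair_big xpredT xpredT (fun (j : 'I_m) (l : 'I_L) => cos (v j 0 / Num.sqrt L%:R))) /=.
by apply: eq_bigr => j _; rewrite prodr_const card_ord.
Qed.

End Rademacher.

Section CharFun.
Variables (R : realType) (n : nat) (K : finType) (w x : 'I_n -> K -> R).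
Hypothesis w_ge0 : forall i k, 0 <= w i k.
Hypothesis w_sum : forall i, \sum_k w i k = 1.
Local Open Scope complex_scope.

Definition charfun i (t : R) : R[i] := \sum_c (w i c)%:C * cis (t * x i c).

(** The law of [X_i - X_i'] for independent copies, carried by [K * K]; its characteristic function
    [psi] is real and is the squared modulus of [charfun]. *)
Definition symw i (c : K * K) : R := w i c.1 * w i c.2.
Definition symx i (c : K * K) : R := x i c.1 - x i c.2.
Definition psi i (t : R) : R := \sum_c symw i c * cos (t * symx i c).

Lemma symw_ge0 i c : 0 <= symw i c. Proof. by rewrite mulr_ge0. Qed.

Lemma symw_sum i : \sum_c symw i c = 1.
Proof.
rewrite /symw -(pair_big xpredT xpredT (fun a b => w i a * w i b)) /=.
by under eq_bigr => a _ do rewrite -mulr_sumr w_sum mulr1.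
Qed.

Lemma normsq_charfun i t : normsq (charfun i t) = psi i t.
Proof.
rewrite /normsq Re_sum Im_sum.
under eq_bigr => c _ do rewrite Re_realM /=.
under [X in _ + X ^+ 2]eq_bigr => c _ do rewrite Im_realM /=.
rewrite !expr2 !big_distrlr /= -big_split /= /psi /symw /symx.
rewrite -(pair_big xpredT xpredT (fun a b => w i a * w i b * cos (t * (x i a - x i b)))) /=.
apply: eq_bigr => a _; rewrite -big_split /=; apply: eq_bigr => b _.
by rewrite mulrBr cosB; ring.
Qed.

Lemma psi_ge0 i t : 0 <= psi i t.
Proof. by rewrite -normsq_charfun normsq_ge0. Qed.

Lemma psi_le1 i t : psi i t <= 1.
Proof.
rewrite -(symw_sum i); apply: ler_sum => c _.
by rewrite -[leRHS]mulr1 ler_wpM2l ?symw_ge0 ?cos_le1.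
Qed.

Lemma psi0 i : psi i 0 = 1.
Proof.
rewrite -(symw_sum i); apply: eq_bigr => c _.
by rewrite mul0r cos0 mulr1.
Qed.

(** Termwise, [1 - cos (2 u) = 2 (1 - cos u) (1 + cos u) <= 4 (1 - cos u)]. *)
Lemma psi_double i t : 1 - psi i (2 * t) <= 4 * (1 - psi i t).
Proof.
have E u : 1 - psi i u = \sum_c symw i c * (1 - cos (u * symx i c)).
  rewrite -[X in X - _](symw_sum i) -sumrB; apply: eq_bigr => c _.
  by ring.
rewrite !E mulr_sumr; apply: ler_sum => c _.
have := symw_ge0 i c; set u := symw i c => u0.
have -> : 2 * t * symx i c = (t * symx i c) *+ 2 by rewrite -mulrA mulr_natl.
rewrite cos_mulr2n; set C := cos _.
have C1 : C <= 1 by exact: cos_le1.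
have : 0 <= u * ((1 - C) ^+ 2 *+ 2) by rewrite mulr_ge0// mulrn_wge0// sqr_ge0.
rewrite !mulr2n; nra.
Qed.

Lemma psi_charfun i t : (psi i t)%:C = \sum_c (symw i c)%:C * cis (t * symx i c).
Proof.
apply/eqP; rewrite eq_complex Re_sum Im_sum; apply/andP; split.
  by apply/eqP; rewrite -[LHS]/(psi i t); apply: eq_bigr => c _; rewrite Re_realM.
under eq_bigr => c _ do rewrite Im_realM /=.
pose f a b := symw i (a, b) * sin (t * symx i (a, b)).
have fN a b : f a b = - f b a.
  rewrite /f /symw /symx /= (mulrC (w i a)) -mulrN -sinN.
  by rewrite -mulrN opprB.
have E : \sum_a \sum_b f a b = - \sum_a \sum_b f a b.
  rewrite {1}exchange_big /= -sumrN; apply: eq_bigr => a _.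
  by rewrite -sumrN; apply: eq_bigr => b _; rewrite fN.
have -> : \sum_c symw i c * sin (t * symx i c) = \sum_a \sum_b f a b.
  by rewrite pair_big; apply: eq_bigr => -[a b].
by apply/eqP; rewrite -[LHS]/(0 : R); lra.
Qed.

Variables (m L : nat) (Om : finType) (g : Om -> 'cV[R]_m) (q : R).
Hypothesis q_ge0 : 0 <= q.
Hypothesis gE : forall v, \sum_om q%:C * cis (dotv (g om) v) = (coskernel L v)%:C.
Variable B : 'M[R]_(m, n).

Lemma dotv_valv (z : 'I_n -> K -> R) om k u :
  dotv (g om) (B *m valv z k - u) =
  - dotv (g om) u + \sum_i dotv (col i B) (g om) * z i (k i).
Proof.
rewrite dotvBr addrC; congr (_ + _); rewrite dotv_mul /dotv.
apply: eq_bigr => i _; rewrite [valv _ _ _ _]mxE; congr (_ * _).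
by rewrite mxE; apply: eq_bigr => j _; rewrite !mxE.
Qed.

(** Expand the kernel into characters. The mean of each factorises over the coordinates, and passing
    to moduli discards the shift [u]. *)
Lemma mean_coskernel_le u :
  mean w (fun k => coskernel L (B *m valv x k - u)) <=
  \sum_om q * \prod_i Num.sqrt (psi i (dotv (col i B) (g om))).
Proof.
pose th i om := dotv (col i B) (g om).
pose Z := \sum_om q%:C * (cis (- dotv (g om) u) * \prod_i charfun i (th i om)).
have -> : mean w (fun k => coskernel L (B *m valv x k - u)) = complex.Re Z.
  transitivity (complex.Re ((mean w (fun k => coskernel L (B *m valv x k - u)))%:C)) => //.
  congr complex.Re; rewrite /Z /mean rmorph_sum /=.
  under [RHS]eq_bigr => om _.
    rewrite bigA_distr_bigA /= mulr_sumr mulr_sumr; over.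
  rewrite exchange_big /=; apply: eq_bigr => k _.
  rewrite rmorphM /= -gE mulr_sumr; apply: eq_bigr => om _.
  rewrite dotv_valv cisD cis_sum rmorph_prod big_split /=.
  by rewrite mulrCA; congr (_ * _); rewrite mulrCA.
rewrite /Z Re_sum; apply: ler_sum => om _; rewrite Re_realM ler_wpM2l//.
apply: le_trans (Re_le_normsq _) _.
rewrite normsqM normsq_cis mul1r sqrt_normsq_prod.
by under eq_bigr => i _ do rewrite normsq_charfun.
Qed.

End CharFun.

(** The way back from frequencies to variables: [psi] is itself a characteristic function, so
    averaging a product of dilated [psi] gives exactly the kernel at the symmetrised variables,
    dilated by [s]. *)
Lemma mean_coskernel_sym (R : realType) n (K : finType) (w x : 'I_n -> K -> R)
    m L (Om : finType) (g : Om -> 'cV[R]_m) (q : R) (B : 'M[R]_(m, n)) (s : 'I_n -> R) :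
  (forall v, \sum_om (real_complex _ q) * cis (dotv (g om) v) = real_complex _ (coskernel L v)) ->
  \sum_om q * \prod_i psi w x i (s i * dotv (col i B) (g om)) =
  mean (symw w) (fun k => coskernel L (B *m valv (fun i c => s i * symx x i c) k)).
Proof.
move=> gE; apply: (@complexI R); rewrite /mean !rmorph_sum /=.
under eq_bigr => om _.
  rewrite rmorphM rmorph_prod /=.
  under eq_bigr => i _ do rewrite psi_charfun.
  rewrite bigA_distr_bigA /= mulr_sumr; over.
rewrite exchange_big /=; apply: eq_bigr => k _.
rewrite rmorphM /= -gE mulr_sumr; apply: eq_bigr => om _.
rewrite -[_ *m _](subr0) dotv_valv cisD cis_sum rmorph_prod big_split /=.
rewrite mulrCA; congr (_ * (_ * _)).
rewrite -[X in X * _]/(cis _).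
have -> : dotv (g om) 0 = 0 by rewrite /dotv big1// => j _; rewrite mxE mulr0.
rewrite oppr0 cis0 mul1r; apply: eq_bigr => i _; congr cis; ring.
Qed.

(** * The Gaussian kernel as a limit of cosine products *)

Section CosinePower.
Variable R : realType.
Local Open Scope classical_set_scope.

Lemma sin_div_cvg (h : nat -> R) : (forall k, 0 < h k) -> h @ \oo --> 0 ->
  (fun k => sin (h k) / h k) @ \oo --> (1 : R).
Proof.
move=> h0 hcvg.
have D : (fun t : R => sin t / t) t @[t --> 0^'+] --> (1 : R).
  apply: cvg_dnbhs_at_right.
  have H := @derivable_sin R 0.
  have E : 'D_1 (@sin R) 0 = 1 by rewrite derive_val cos0.
  rewrite /derivable in H; rewrite /derive in E; rewrite -E.
  apply: cvg_trans H; apply: near_eq_cvg; near=> t.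
  by rewrite /= sin0 subr0 addr0 /GRing.scale /= mulr1 mulrC.
by have /cvg_at_rightP := D; apply.
Unshelve. all: by end_near. Qed.

Lemma exprB_le (a b : R) L : `|a| <= 1 -> `|b| <= 1 ->
  `|a ^+ L - b ^+ L| <= L%:R * `|a - b|.
Proof.
move=> a1 b1; rewrite subrXX normrM mulrC ler_wpM2r//.
apply: le_trans (ler_norm_sum _ _ _) _.
rewrite -[leRHS]mulr1 mulr_natl -[X in _ <= _ *+ X]card_ord -sumr_const.
apply: ler_sum => i _; rewrite normrM !normrX.
by rewrite mulr_ile1 ?exprn_ge0// exprn_ile1.
Qed.

(** Compare with [b k ^+ k.+1], which is constantly the limit. By [exprB_le] the difference of the
    powers is at most [k.+1] times that of the bases, and both [k.+1 * (1 - cos _)] and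
    [k.+1 * (1 - b k)] tend to [lam]. *)
Lemma cvg_cos_pow (z : R) :
  (fun k => cos (z / Num.sqrt k.+1%:R) ^+ k.+1) @ \oo --> expR (- (z ^+ 2 / 2)).
Proof.
have [->|z0] := eqVneq z 0.
  rewrite expr0n mul0r oppr0 expR0.
  under eq_fun do rewrite mul0r cos0 expr1n.
  exact: cvg_cst.
have n0 k : 0 < k.+1%:R :> R by [].
have s0 k : 0 < Num.sqrt k.+1%:R :> R by rewrite sqrtr_gt0.
(* Half the angle, so that [1 - cos (2 h) = 2 (sin h)^2] reduces to the limit of [sin h / h]. *)
pose h k : R := `|z| / 2 / Num.sqrt k.+1%:R.
have hpos k : 0 < h k by rewrite !divr_gt0// normr_gt0.
have hcvg : h @ \oo --> 0.
  rewrite -[X in _ --> X](mulr0 (`|z| / 2)); apply: cvgMl_tmp.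
  have -> : (fun k => (Num.sqrt k.+1%:R)^-1) = (fun k => Num.sqrt (harmonic k)) :> (nat -> R).
    by apply/funext => k; rewrite /harmonic /= sqrtrV.
  rewrite -[X in _ --> X](sqrtr0 R).
  apply: (@cvg_comp _ _ _ harmonic Num.sqrt _ (nbhs (0 : R))); first exact: cvg_harmonic.
  exact: sqrt_continuous.
pose lam := z ^+ 2 / 2.
pose b k := expR (- (lam / k.+1%:R)).
have lam0 : 0 < lam by rewrite divr_gt0// exprn_even_gt0.
have bL k : expR (- lam) = b k ^+ k.+1.
  by rewrite /b -expRM_natl; congr expR; field; rewrite ?gt_eqF.
have C1 : (fun k => k.+1%:R * (1 - cos (z / Num.sqrt k.+1%:R))) @ \oo --> lam.
  have -> : (fun k => k.+1%:R * (1 - cos (z / Num.sqrt k.+1%:R))) =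
      (fun k => lam * (sin (h k) / h k) ^+ 2).
    apply/funext => k.
    have -> : cos (z / Num.sqrt k.+1%:R) = cos (h k *+ 2).
      rewrite -cos_norm normrM normfV (gtr0_norm (s0 k)); congr cos.
      by rewrite /h mulr2n; field; rewrite gt_eqF.
    rewrite cos_mulr2n expr_div_n sin2cos2.
    have -> : h k ^+ 2 = lam / 2 / k.+1%:R.
      rewrite /h !expr_div_n sqr_sqrtr// real_normK ?num_real//.
      by rewrite /lam; field; rewrite gt_eqF.
    rewrite mulr2n; field.
    by rewrite (gt_eqF lam0) gt_eqF.
  suff : (fun k => lam * (sin (h k) / h k) ^+ 2) @ \oo --> lam * (1 * 1).
    by rewrite !mulr1.
  apply: cvgMl_tmp; under eq_fun do rewrite expr2.
  by apply: cvgM; exact: sin_div_cvg.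
have C2 : (fun k => k.+1%:R * (1 - b k)) @ \oo --> lam.
  apply: (@squeeze_cvgr _ _ _ _ (fun k => lam - lam ^+ 2 / k.+1%:R) (fun=> lam)).
  - near=> k; set L := k.+1%:R; have L0 : 0 < L by exact: n0.
    set y := lam / L; have y0 : 0 < y by rewrite divr_gt0.
    have -> : b k = (expR y)^-1 by rewrite /b expRN.
    have e1 := expR_ge1Dx y; have e0 := expR_gt0 y.
    have i1 : (expR y)^-1 * (1 + y) <= 1 by rewrite mulrC ler_pdivrMr// mul1r.
    have i0 : 0 < (expR y)^-1 by rewrite invr_gt0.
    have i2 : 1 - y <= (expR y)^-1 by rewrite -expRN; exact: expR_ge1Dx.
    have -> : lam - lam ^+ 2 / L = L * (y - y ^+ 2).
      by rewrite /y; field; rewrite gt_eqF.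
    have E : lam = L * y by rewrite /y; field; rewrite gt_eqF.
    by apply/andP; split; rewrite ?[leRHS]E ler_pM2l//; nra.
  - rewrite -[X in _ --> X](subr0) -(mulr0 (lam ^+ 2)).
    apply: cvgB; first exact: cvg_cst.
    apply: cvgMl_tmp; exact: cvg_harmonic.
  - exact: cvg_cst.
have C3 : (fun k => cos (z / Num.sqrt k.+1%:R) ^+ k.+1 - b k ^+ k.+1) @ \oo --> (0:R).
  apply/norm_cvg0P.
  apply: (@squeeze_cvgr _ _ _ _ (fun=> 0)
    (fun k => `|k.+1%:R * (1 - cos (z / Num.sqrt k.+1%:R)) - k.+1%:R * (1 - b k)|)).
  - near=> k; rewrite normr_ge0 /=.
    apply: le_trans (@exprB_le _ _ _ _ _) _.
    + exact: cos_max.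
    + by rewrite ger0_norm ?expR_ge0// expR_le1 oppr_le0 divr_ge0// ltW.
    + rewrite -mulrBr normrM (gtr0_norm (n0 k)) ler_pM2l// distrC.
      by rewrite le_eqVlt; apply/orP; left; apply/eqP; congr `|_|; ring.
  - exact: cvg_cst.
  - rewrite -(normr0 R) -(subrr lam); apply: cvg_norm; exact: cvgB.
rewrite -/lam -[X in _ --> X]add0r.
have -> : (fun k => cos (z / Num.sqrt k.+1%:R) ^+ k.+1) =
   (fun k => (cos (z / Num.sqrt k.+1%:R) ^+ k.+1 - b k ^+ k.+1) + expR (- lam)).
  by apply/funext => k; rewrite (bL k) subrK.
by apply: cvgD => //; exact: cvg_cst.
Unshelve. all: by end_near. Qed.

Lemma cvg_coskernel m (v : 'cV[R]_m) :
  (fun k => coskernel k.+1 v) @ \oo --> gk v.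
Proof.
have -> : gk v = \prod_j expR (- (v j 0 ^+ 2 / 2)).
  by rewrite -expR_sum /gk nsqE sumrN mulr_suml.
by apply: (cvg_big (@mul_continuous R)) => j _; exact: cvg_cos_pow.
Qed.

Lemma cvg_bigsum (I : Type) (r : seq I) (f : I -> nat -> R) l :
  (forall i, f i @ \oo --> l i) ->
  (fun k => \sum_(i <- r) f i k) @ \oo --> \sum_(i <- r) l i.
Proof.
have cadd : continuous (fun z : R * R => z.1 + z.2).
  by move=> z; apply: cvgD; [exact: cvg_fst|exact: cvg_snd].
by move=> fl; apply: (cvg_big cadd) => i _; exact: fl.
Qed.

Lemma cvg_mean n (K : finType) (w : 'I_n -> K -> R) (f : nat -> {ffun 'I_n -> K} -> R) l :
  (forall k, f ^~ k @ \oo --> l k) -> (fun j => mean w (f j)) @ \oo --> mean w l.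
Proof.
by move=> fl; rewrite /mean; apply: cvg_bigsum => k; apply: cvgMl_tmp; exact: fl.
Qed.

End CosinePower.

(** * Finitely supported laws *)

Section SmallDiagonal.
Variables (R : realType) (n : nat) (K : finType) (w x : 'I_n -> K -> R) (p : R).
Hypothesis w_ge0 : forall i k, 0 <= w i k.
Hypothesis w_sum : forall i, \sum_k w i k = 1.
Hypothesis p_gt0 : 0 < p.
Hypothesis conc : forall i a, \sum_(k | `|x i k - a| <= 1) w i k <= p.

(** Condition on the second copy, which only shifts the interval. *)
Lemma conc_sym i a : \sum_(c | `|symx x i c - a| <= 1) symw w i c <= p.
Proof.
rewrite big_mkcond /=.
have -> : \sum_c (if `|symx x i c - a| <= 1 then symw w i c else 0) =
    \sum_l \sum_k (if `|x i k - (x i l + a)| <= 1 then w i k * w i l else 0).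
  rewrite exchange_big pair_big; apply: eq_bigr => -[k l] _ /=.
  by rewrite /symx /symw opprD addrA.
apply: (@le_trans _ _ (\sum_l p * w i l)); last by rewrite -mulr_sumr w_sum mulr1.
apply: ler_sum => l _; rewrite -big_mkcond -mulr_suml ler_wpM2r//.
Qed.

Variables (m : nat) (B : 'M[R]_(m, n)).
Hypothesis B_contr : contraction B.
Hypothesis B_small : forall i, gram B i i <= 2^-1.
Let M := gram B.
Let W := dpp M.

Lemma gram_ge0 i : 0 <= M i i.
Proof. by rewrite /M gram_diag nsq_ge0. Qed.

Lemma exists_scales : exists J : 'I_n -> nat, forall i,
  2 * 4 ^+ J i * M i i <= 1 /\ (0 < M i i -> 1 <= 8 * 4 ^+ J i * M i i).
Proof.
suff H i : exists J, 2 * 4 ^+ J * M i i <= 1 /\ (0 < M i i -> 1 <= 8 * 4 ^+ J * M i i).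
  by have [J HJ] := boolp.choice H; exists J.
have [Mi|Mi] := ltP 0 (M i i).
  have [|J [J1 J2]] := @exists_pow4_scale R (M i i); first by rewrite Mi B_small.
  by exists J.
exists 0%N; split=> //.
by rewrite expr0 mulr1; have := B_small i; rewrite -/M; lra.
Qed.

Variable J : 'I_n -> nat.
Hypothesis J_le : forall i, 2 * 4 ^+ J i * M i i <= 1.
Implicit Types (S : {set 'I_n}) (i : 'I_n).
Hypothesis J_ge : forall i, 0 < M i i -> 1 <= 8 * 4 ^+ J i * M i i.

Let W_ge0 S : 0 <= W S. Proof. exact: dpp_ge0 (gram_sub_identity B_contr) _. Qed.
Let W_sum : \sum_S W S = 1. Proof. exact: sum_dpp. Qed.
Let W_marg i : \sum_(S : {set 'I_n} | i \in S) W S = M i i.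
Proof. exact: dpp_marginal. Qed.

(** Hoelder in exponential form. As [ln (r i) <= 0] and [2 * 4 ^+ J i * M i i <= 1], the sum of the
    logarithms is at most the [W]-average of the sums of [g] over [S]; Jensen then applies after a
    shift by the free parameters [beta S]. *)
Lemma prod_le_hoelder (beta : {set 'I_n} -> R) (r : 'I_n -> R) :
  (forall i, 0 <= r i <= 1) ->
  \prod_i r i <= expR (\sum_S W S * beta S) *
    \sum_S W S * (expR (- beta S) * \prod_(i in S) (r i ^+ 2) ^+ (4 ^ J i)).
Proof.
move=> r01; have r_ge0 i : 0 <= r i by case/andP: (r01 i).
have [/existsP[i /eqP ri]|rpos] := boolP [exists i, r i == 0].
  rewrite (bigD1 i) //= ri mul0r mulr_ge0 ?expR_ge0// sumr_ge0// => S _.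
  rewrite !mulr_ge0 ?expR_ge0// prodr_ge0// => j _.
  by rewrite !exprn_ge0.
have {}rpos i : 0 < r i.
  rewrite lt_neqAle r_ge0 andbT eq_sym.
  by apply: contra rpos => ri; apply/existsP; exists i.
pose g i := (2 * 4 ^+ J i) * ln (r i).
have gE i : (r i ^+ 2) ^+ (4 ^ J i) = expR (g i).
  rewrite -exprM /g -natrX -natrM expRM_natl lnK// posrE//.
apply: (@le_trans _ _ (expR (\sum_S W S * (\sum_(i in S) g i)))).
  rewrite (sum_marginal W_marg).
  have -> : \prod_i r i = expR (\sum_i ln (r i)).
    by rewrite expR_sum; apply: eq_bigr => i _; rewrite lnK// posrE.
  rewrite ler_expR; apply: ler_sum => i _.
  have l0 : ln (r i) <= 0 by rewrite ln_le0//; case/andP: (r01 i).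
  rewrite /g mulrA -[leLHS]mul1r ler_wnM2r// mulrC; exact: J_le.
have -> : \sum_S W S * (\sum_(i in S) g i) =
    (\sum_S W S * beta S) + \sum_S W S * (\sum_(i in S) g i - beta S).
  by rewrite -big_split; apply: eq_bigr => S _ /=; rewrite -mulrDr subrKC.
rewrite expRD ler_wpM2l ?expR_ge0//.
apply: le_trans (jensen_expR _ W_ge0 W_sum) _.
apply: ler_sum => S _; rewrite ler_wpM2l// addrC expRD expR_sum.
by rewrite ler_wpM2l ?expR_ge0//; apply: ler_prod => i _; rewrite gE expR_ge0 lexx.
Qed.

Let N := (\max_i J i).+1.

(** The coefficients of [pow4_le_sum_dilates], padded by zeros to one index type for all [i].
    Outside [S] the single term has scale [0], where [psi] equals [1]. *)
Definition dil_coef (S : {set 'I_n}) i (j : 'I_N) : R :=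
  if i \in S then (if (j <= J i)%N then 16 * 4 ^- (J i - j) else 0)
  else (j == ord0)%:R.

Definition dil_scale (S : {set 'I_n}) i (j : 'I_N) : R :=
  if i \in S then 2 ^+ j else 0.

Lemma dil_coef_ge0 S i j : 0 <= dil_coef S i j.
Proof.
rewrite /dil_coef; case: ifP => _; last by [].
by case: ifP => // _; rewrite mulr_ge0// invr_ge0 exprn_ge0.
Qed.

Lemma sum_dil_coef S i (F : nat -> R) : i \in S ->
  \sum_j dil_coef S i j * F j = \sum_(j < (J i).+1) 16 * 4 ^- (J i - j) * F j.
Proof.
move=> iS; have JN : ((J i).+1 <= N)%N by rewrite ltnS leq_bigmax.
rewrite (big_ord_widen N (fun j => 16 * 4 ^- (J i - j) * F j) JN) [RHS]big_mkcond /=.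
apply: eq_bigr => j _; rewrite /dil_coef iS ltnS.
by case: ifP => // _; rewrite mul0r.
Qed.

(** Bound each factor by its dilates and expand the product of sums over the choice functions [phi].
    The right-hand products run over all [i], the form needed by [mean_coskernel_sym]. *)
Lemma prod_psi_le S (y : 'I_n -> R) :
  \prod_(i in S) psi w x i (y i) ^+ (4 ^ J i) <=
  \sum_(phi : {ffun 'I_n -> 'I_N}) (\prod_i dil_coef S i (phi i)) *
    \prod_i psi w x i (dil_scale S i (phi i) * y i).
Proof.
under [leRHS]eq_bigr => phi _ do rewrite -big_split /=.
rewrite -(bigA_distr_bigA (fun i j => dil_coef S i j * psi w x i (dil_scale S i j * y i))).
rewrite big_mkcond /=; apply: ler_prod => i _.
case: ifPn => iS; last first.
  rewrite ler01 /= (bigD1 ord0) //= /dil_coef /dil_scale (negbTE iS) eqxx mul0r.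
  rewrite (psi0 x w_sum) mul1r lerDl sumr_ge0//.
rewrite exprn_ge0 ?psi_ge0//=.
under eq_bigr => j _ do rewrite /dil_scale iS.
rewrite (sum_dil_coef (fun j => psi w x i (2 ^+ j * y i)) iS).
have := @pow4_le_sum_dilates R (fun j => psi w x i (2 ^+ j * y i)) (J i).
rewrite expr0 mul1r; apply=> j; first by rewrite psi_ge0 ?psi_le1.
by rewrite exprS -mulrA; exact: psi_double.
Qed.

Lemma sum_dyadic_le k : \sum_(j < k.+1) 16 * 4 ^- (k - j) * 2 ^- j <= 32 * 2 ^- k :> R.
Proof.
elim: k => [|k IH]; first by rewrite big_ord1 subnn !expr0 invr1; lra.
rewrite big_ord_recr /= subnn expr0 invr1 mulr1.
have -> : \sum_(j < k.+1) 16 * 4 ^- (k.+1 - j) * 2 ^- j =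
   4^-1 * \sum_(j < k.+1) 16 * 4 ^- (k - j) * 2 ^- j :> R.
  rewrite mulr_sumr; apply: eq_bigr => j _.
  by rewrite subSn -1?ltnS// exprS invfM; ring.
have -> : 2 ^- k.+1 = 2^-1 * 2 ^- k :> R by rewrite exprS invfM.
lra.
Qed.

(** Here [768 = 8 * 32 * 3]: the constants of [gauss_smoothing_le] and [sum_dyadic_le], and the
    bound [2 ^- J i <= 3 * Num.sqrt (M i i)]. *)
Let b i : R := 768 * p * Num.sqrt (M i i).

Lemma sum_dil_le S i : i \in S -> 0 < M i i ->
  \sum_j dil_coef S i j * (8 * p / 2 ^+ j) <= b i.
Proof.
move=> iS Mi; rewrite (sum_dil_coef (fun j => 8 * p / 2 ^+ j) iS).
have -> : \sum_(j < (J i).+1) 16 * 4 ^- (J i - j) * (8 * p / 2 ^+ j) =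
    8 * p * \sum_(j < (J i).+1) 16 * 4 ^- (J i - j) * 2 ^- j.
  by rewrite mulr_sumr; apply: eq_bigr => j _; ring.
apply: (@le_trans _ _ (8 * p * (32 * 2 ^- J i))).
  by rewrite ler_pM2l ?mulr_gt0// sum_dyadic_le.
have H : 2 ^- J i <= 3 * Num.sqrt (M i i).
  rewrite -ler_sqr ?nnegrE ?invr_ge0 ?exprn_ge0 ?mulr_ge0 ?sqrtr_ge0//.
  rewrite exprMn sqr_sqrtr ?(ltW Mi)// exprVn -exprM mulnC exprM -[leLHS]mul1r.
  rewrite (_ : 2 ^+ 2 = 4); last by rewrite -natrX.
  rewrite ler_pdivrMr ?exprn_gt0//; apply: le_trans (J_ge Mi) _.
  have : 0 <= 4 ^+ J i * M i i by rewrite mulr_ge0 ?exprn_ge0// ltW.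
  lra.
by have := ler_wpM2l (ltW p_gt0) H; rewrite /b; lra.
Qed.

(** Dilating by [2 ^ phi i] improves the one-dimensional bound by that factor, and [dpp_le] turns
    [W S] into the minor that [mean_gk_det] requires. *)
Lemma mean_gk_dil_le S (phi : {ffun 'I_n -> 'I_N}) :
  (\prod_i dil_coef S i (phi i)) *
  (mean (symw w) (fun k => gk (B *m valv (fun i c => dil_scale S i (phi i) * symx x i c) k)) *
   Num.sqrt (W S)) <=
  \prod_i (dil_coef S i (phi i) * (if i \in S then 8 * p / 2 ^+ phi i else 1)).
Proof.
rewrite big_split /=.
have [/forallP H|] := boolP [forall i, (i \in S) ==> (phi i <= J i)%N]; last first.
  case/fintype.forallPn => i; rewrite negb_imply => /andP[iS ij].
  by rewrite (bigD1 i) //= {1 3}/dil_coef iS (negbTE ij) !mul0r.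
rewrite ler_wpM2l ?prodr_ge0// => [i _|]; first exact: dil_coef_ge0.
rewrite -big_mkcond /=.
pose z i c := dil_scale S i (phi i) * symx x i c.
rewrite -/z; set E := mean _ _.
have E0 : 0 <= E.
  rewrite /E /mean sumr_ge0// => k _; rewrite mulr_ge0 ?expR_ge0// prodr_ge0// => i _.
  exact: symw_ge0.
apply: (@le_trans _ _ (E * Num.sqrt (\det (mix_rows S M 1%:M)))).
  rewrite ler_wpM2l// ler_wsqrtr//; apply: dpp_le; exact: gram_sub_identity.
have -> : E = mean (symw w) (fun k => gk (B *m valv z k - 0)).
  by apply: eq_bigr => k _; rewrite subr0.
apply: mean_gk_det.
- by move=> i c; exact: symw_ge0.
- by move=> i; exact: symw_sum.
- by move=> i _; rewrite divr_ge0 ?exprn_ge0// mulr_ge0// ltW.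
move=> i mu a iS /andP[mu0 muM]; rewrite /z /dil_scale iS.
set s := 2 ^+ phi i; have s0 : 0 < s by rewrite exprn_gt0.
have Hi : (phi i <= J i)%N by have := H i; rewrite iS.
(* The cap [phi i <= J i] keeps the rescaled Gaussian within the range of [gauss_smoothing_le]. *)
have ms : mu * s ^+ 2 <= 1.
  apply: le_trans (J_le i); apply: (@le_trans _ _ (M i i * 4 ^+ J i)).
    rewrite ler_pM ?sqr_ge0 ?(ltW mu0)// /s -exprM mulnC exprM (_ : 2 ^+ 2 = 4) -?natrX//.
    by rewrite !natrX ler_weXn2l// ler1n.
  have : 0 <= M i i * 4 ^+ J i by rewrite mulr_ge0 ?gram_ge0 ?exprn_ge0.
  lra.
have G := @gauss_smoothing_le R _ (symw w i) (symx x i) p (symw_ge0 w_ge0 i) (conc_sym i)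
  (mu * s ^+ 2) (a / s).
have {}G := G _; rewrite ms mulr_gt0 ?exprn_gt0// in G; have {}G := G isT.
under eq_bigr => c _.
  rewrite (_ : mu / 2 * (s * symx x i c - a) ^+ 2 =
      mu * s ^+ 2 / 2 * (symx x i c - a / s) ^+ 2); last first.
    by field; rewrite gt_eqF.
  over.
have sm0 : 0 < Num.sqrt mu by rewrite sqrtr_gt0.
apply: le_trans (ler_wpM2l (ltW sm0) G) _.
rewrite sqrtrM ?(ltW mu0)// sqrtr_sqr gtr0_norm// le_eqVlt; apply/orP; left; apply/eqP.
by field; rewrite !gt_eqF.
Qed.

Lemma sum_dil_mean_le S : 0 < W S ->
  \sum_(phi : {ffun 'I_n -> 'I_N}) (\prod_i dil_coef S i (phi i)) *
    (mean (symw w) (fun k => gk (B *m valv (fun i c => dil_scale S i (phi i) * symx x i c) k)) *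
     Num.sqrt (W S)) <= \prod_(i in S) b i.
Proof.
move=> WS; apply: le_trans (ler_sum _ (fun phi _ => mean_gk_dil_le S phi)) _.
rewrite -(bigA_distr_bigA (fun i j => dil_coef S i j * (if i \in S then 8 * p / 2 ^+ j else 1))).
rewrite [leRHS]big_mkcond /=; apply: ler_prod => i _; case: ifPn => iS.
  rewrite sum_dil_le// ?andbT; last exact: (marginal_gt0 W_ge0 W_marg iS).
  rewrite sumr_ge0// => j _; rewrite mulr_ge0 ?dil_coef_ge0// divr_ge0 ?exprn_ge0//.
  by rewrite mulr_ge0// ltW.
rewrite sumr_ge0 => [|j _]; last by rewrite mulr1 dil_coef_ge0.
rewrite (bigD1 ord0) //= /dil_coef (negbTE iS) eqxx mul1r big1 ?addr0// => j j0.
by rewrite (negbTE j0) mul0r.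
Qed.

(** Chosen so that [expR (- beta S)] is the inverse of the bound on the [S]-term, which makes the
    remaining average at most one. *)
Let beta (S : {set 'I_n}) : R :=
  \sum_(i in S) (ln (768 * p) + ln (M i i) / 2) - ln (W S) / 2.

Let c_gt0 : 0 < 768 * p. Proof. by rewrite pmulr_rgt0 ?ltr0n. Qed.

Lemma expRN_beta S : 0 < W S -> expR (- beta S) = Num.sqrt (W S) / \prod_(i in S) b i.
Proof.
move=> WS; rewrite /beta opprB expRD expRN expR_sum; congr (_ / _).
  by rewrite -powR12_sqrt ?(ltW WS)// /powR gt_eqF// mulrC.
apply: eq_bigr => i iS.
have Mi := marginal_gt0 W_ge0 W_marg iS WS.
rewrite expRD; congr (_ * _); first exact: lnK.
by rewrite -powR12_sqrt ?(ltW Mi)// /powR gt_eqF// mulrC.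
Qed.

(** Half of the entropy inequality cancels the terms [M i i * ln (M i i) / 2] and leaves half the
    trace. *)
Lemma sum_beta_le :
  \sum_S W S * beta S <= \sum_i M i i * (ln (768 * p) + 2^-1).
Proof.
have -> : \sum_S W S * beta S = \sum_S W S * (\sum_(i in S) (ln (768 * p) + ln (M i i) / 2))
    - (\sum_S W S * ln (W S)) / 2.
  by rewrite mulr_suml -sumrB; apply: eq_bigr => S _; rewrite mulrBr mulrA.
rewrite (sum_marginal W_marg).
have := entropy_le_marginals W_ge0 W_sum W_marg.
have -> : \sum_i M i i * (ln (768 * p) + ln (M i i) / 2) =
    \sum_i M i i * ln (768 * p) + (\sum_i M i i * ln (M i i)) / 2.
  by rewrite mulr_suml -big_split; apply: eq_bigr => i _ /=; ring.
have -> : \sum_i M i i * (ln (768 * p) + 2^-1) =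
    \sum_i M i i * ln (768 * p) + (\sum_i M i i) / 2.
  by rewrite mulr_suml -big_split; apply: eq_bigr => i _ /=; ring.
lra.
Qed.

Let dil_val S (phi : {ffun 'I_n -> 'I_N}) i c : R := dil_scale S i (phi i) * symx x i c.

(** For fixed [L]: pass to frequencies, apply Hoelder and dilates at each frequency, then return to
    variables for each [S] and [phi]. *)
Lemma mean_coskernel_le_dil L u :
  mean w (fun k => coskernel L (B *m valv x k - u)) <=
  expR (\sum_S W S * beta S) * \sum_S W S * (expR (- beta S) *
    \sum_(phi : {ffun 'I_n -> 'I_N}) (\prod_i dil_coef S i (phi i)) *
      mean (symw w) (fun k => coskernel L (B *m valv (dil_val S phi) k))).
Proof.
have [Om [g [q [q0 gE]]]] := coskernel_charfun R L m.
have H0 := mean_coskernel_le w x q0 gE B u.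
apply: le_trans H0 _.
pose Y i om := dotv (col i B) (g om).
pose F S om := \prod_(i in S) psi w x i (Y i om) ^+ (4 ^ J i).
apply: (@le_trans _ _ (\sum_om q * (expR (\sum_S W S * beta S) *
    \sum_S W S * (expR (- beta S) * F S om)))).
  apply: ler_sum => om _; rewrite ler_wpM2l//.
  have := @prod_le_hoelder beta (fun i => Num.sqrt (psi w x i (Y i om))).
  have H i : 0 <= Num.sqrt (psi w x i (Y i om)) <= 1.
    by rewrite sqrtr_ge0 -sqrtr1 ler_wsqrtr// psi_le1.
  move=> /(_ H) /le_trans; apply; rewrite ler_wpM2l ?expR_ge0//.
  rewrite le_eqVlt; apply/orP; left; apply/eqP; apply: eq_bigr => S _.
  congr (_ * (_ * _)); apply: eq_bigr => i _; rewrite sqr_sqrtr//.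
  exact: psi_ge0.
rewrite (_ : \sum_om _ = expR (\sum_S W S * beta S) *
    \sum_S W S * (expR (- beta S) * \sum_om q * F S om)); last first.
  under eq_bigr => om _ do rewrite mulrCA.
  rewrite -mulr_sumr; congr (_ * _).
  under eq_bigr => om _ do rewrite mulr_sumr.
  rewrite exchange_big; apply: eq_bigr => S _ /=.
  rewrite !mulr_sumr; apply: eq_bigr => om _; ring.
rewrite ler_wpM2l ?expR_ge0//; apply: ler_sum => S _.
rewrite ler_wpM2l// ler_wpM2l ?expR_ge0//.
apply: (@le_trans _ _ (\sum_om q * \sum_(phi : {ffun 'I_n -> 'I_N}) (\prod_i dil_coef S i (phi i)) *
    \prod_i psi w x i (dil_scale S i (phi i) * Y i om))).
  by apply: ler_sum => om _; rewrite ler_wpM2l//; exact: prod_psi_le.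
under eq_bigr => om _ do rewrite mulr_sumr.
rewrite exchange_big; apply: ler_sum => phi _ /=.
rewrite -(mean_coskernel_sym w x B (fun i => dil_scale S i (phi i)) gE) mulr_sumr.
by apply: ler_sum => om _; rewrite mulrCA.
Qed.

Lemma mean_gk_small_aux u : mean w (fun k => gk (B *m valv x k - u)) <=
  expR (\sum_i M i i * (ln (768 * p) + 2^-1)).
Proof.
apply: (@le_trans _ _ (expR (\sum_S W S * beta S))); last first.
  by rewrite ler_expR sum_beta_le.
pose rhs := expR (\sum_S W S * beta S) * \sum_S W S * (expR (- beta S) *
    \sum_(phi : {ffun 'I_n -> 'I_N}) (\prod_i dil_coef S i (phi i)) *
      mean (symw w) (fun k => gk (B *m valv (dil_val S phi) k))).
apply: (@le_trans _ _ rhs).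
  have cl : ((fun L => mean w (fun k => coskernel L.+1 (B *m valv x k - u))) @ \oo -->
      mean w (fun k => gk (B *m valv x k - u)))%classic.
    by apply: cvg_mean => k; exact: cvg_coskernel.
  have cr : ((fun L => expR (\sum_S W S * beta S) * \sum_S W S * (expR (- beta S) *
    \sum_(phi : {ffun 'I_n -> 'I_N}) (\prod_i dil_coef S i (phi i)) *
      mean (symw w) (fun k => coskernel L.+1 (B *m valv (dil_val S phi) k)))) @ \oo --> rhs)%classic.
    apply: cvgMl_tmp; apply: cvg_bigsum => S; apply: cvgMl_tmp; apply: cvgMl_tmp.
    apply: cvg_bigsum => phi; apply: cvgMl_tmp; apply: cvg_mean => k.
    exact: cvg_coskernel.
  apply: (ler_cvg_to cl cr); near=> L; exact: mean_coskernel_le_dil.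
rewrite /rhs -[leRHS]mulr1 ler_wpM2l ?expR_ge0// -[leRHS]W_sum.
apply: ler_sum => S _.
have [WS|WS] := ltP 0 (W S); last first.
  have -> : W S = 0 by apply/eqP; rewrite eq_le WS W_ge0.
  by rewrite mul0r.
rewrite -[leRHS]mulr1 ler_wpM2l ?(ltW WS)// expRN_beta//.
have bpos : 0 < \prod_(i in S) b i.
  apply: prodr_gt0 => i iS; have Mi := marginal_gt0 W_ge0 W_marg iS WS.
  by rewrite pmulr_rgt0 ?c_gt0// sqrtr_gt0.
rewrite mulrAC ler_pdivrMr// mul1r.
apply: le_trans (sum_dil_mean_le WS).
rewrite mulr_sumr; apply: ler_sum => phi _.
by rewrite mulrCA ler_wpM2l ?prodr_ge0// => [i _|]; [exact: dil_coef_ge0|rewrite mulrC].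
Unshelve. all: by end_near. Qed.

End SmallDiagonal.

Lemma mean_gk_small (R : realType) n (K : finType) (w x : 'I_n -> K -> R) (p : R)
    m (B : 'M[R]_(m, n)) u :
  (forall i k, 0 <= w i k) -> (forall i, \sum_k w i k = 1) -> 0 < p ->
  (forall i a, \sum_(k | `|x i k - a| <= 1) w i k <= p) ->
  contraction B -> (forall i, gram B i i <= 2^-1) ->
  mean w (fun k => gk (B *m valv x k - u)) <=
  expR (\tr (gram B) * (ln (768 * p) + 2^-1)).
Proof.
move=> w0 w1 p0 conc cB sB; rewrite mulr_suml.
have [J HJ] := exists_scales sB.
by apply: (@mean_gk_small_aux _ _ _ _ _ _ w0 w1 p0 conc _ _ cB J) => i; case: (HJ i).
Qed.

(* Coordinates with a diagonal entry above [1/2] are integrated out one at a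
   time, each lowering the trace by at most one. *)
Lemma mean_gk_le (R : realType) n (K : finType) (w x : 'I_n -> K -> R) (p : R)
    m (B : 'M[R]_(m, n)) u :
  (forall i k, 0 <= w i k) -> (forall i, \sum_k w i k = 1) -> 0 < p ->
  (forall i a, \sum_(k | `|x i k - a| <= 1) w i k <= p) ->
  2 * (768 * p) <= 1 -> contraction B ->
  mean w (fun k => gk (B *m valv x k - u)) <= expR (\tr (gram B) * ln (2 * (768 * p))).
Proof.
move=> w0 w1 p0 conc p1.
have [d dE] : exists d, d = 768 * p by exists (768 * p).
have d0 : 0 < d by rewrite dE pmulr_rgt0 ?ltr0n.
rewrite -dE in p1 *.
move: {2}#|[set i | 2^-1 < gram B i i]%SET| (leqnn #|[set i | 2^-1 < gram B i i]%SET|) => s.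
elim: s B u => [|s IH] B u cs cB.
  have sB i : gram B i i <= 2^-1.
    rewrite leNgt; apply/negP => Bi; move: cs; rewrite leqn0 finset.cards_eq0.
    by move=> /eqP/finset.setP/(_ i); rewrite finset.inE Bi finset.inE.
  apply: le_trans (mean_gk_small u w0 w1 p0 conc cB sB) _.
  rewrite ler_expR ler_wpM2l ?sumr_ge0// => [i _|]; first exact: gram_ge0.
  (* The factor [expR (2^-1)] per unit of trace is absorbed into the constant [2]. *)
  rewrite -[2^-1]expRK -dE -lnM ?posrE ?expR_gt0//.
  rewrite ler_ln ?posrE ?mulr_gt0 ?expR_gt0//.
  by rewrite mulrC ler_pM2r// expR_half_le2.
have [/existsP[i Bi]|nB] := boolP [exists i, 2^-1 < gram B i i]; last first.
  apply: IH => //; rewrite (_ : [set i | _]%SET = finset.set0) ?finset.cards0//.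
  apply/finset.setP => i; rewrite !finset.inE; apply/negbTE; apply: contra nB => Bi.
  by apply/existsP; exists i.
have b0 : nsq (col i B) != 0.
  by rewrite -gram_diag gt_eqF//; apply: lt_trans Bi; rewrite invr_gt0.
set mu := gram B i i in Bi.
have mu0 : 0 < mu by apply: lt_trans Bi; rewrite invr_gt0.
have mu1 : mu <= 1 by exact: gram_diag_le1.
have step := @mean_gk_step _ _ _ w w0 w1 x m B u i (8 * p / Num.sqrt mu) b0.
apply: le_trans (step _) _ => [a|].
  by rewrite -gram_diag; apply: gauss_smoothing_le => //; rewrite mu0.
have cD : contraction (deflate B i) by exact: contraction_deflate.
apply: le_trans (ler_wpM2l _ (IH (deflate B i) _ _ cD)) _.
- by rewrite divr_ge0 ?sqrtr_ge0// mulr_ge0// ltW.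
(* Deflation lowers every diagonal entry and sends the [i]-th to zero, so the set of large entries
   strictly shrinks. *)
- rewrite -ltnS; apply: leq_trans cs; apply: proper_card.
  apply/fintype.properP; split.
    apply/fintype.subsetP => j; rewrite !finset.inE => /lt_le_trans; apply.
    exact: gram_deflate_diag_le.
  exists i; rewrite !finset.inE// -leNgt gram_diag col_deflate// /nsq /dotv big1 => [|j _].
    by rewrite invr_ge0.
  by rewrite mxE mul0r.
have lp : ln (2 * d) <= 0 by rewrite ln_le0.
apply: (@le_trans _ _ (expR (ln (2 * d)) * expR (\tr (gram (deflate B i)) * ln (2 * d)))).
  rewrite ler_wpM2r ?expR_ge0// lnK ?posrE ?mulr_gt0//.
  (* As [mu > 1/2], one elimination costs [8 * p / Num.sqrt mu <= 2 * d]. *)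
  have sm : 2^-1 <= Num.sqrt mu.
    rewrite -ler_sqr ?nnegrE ?sqrtr_ge0// sqr_sqrtr ?(ltW mu0)//; lra.
  rewrite ler_pdivrMr ?sqrtr_gt0//.
  have := ler_wpM2l (ltW d0) sm; lra.
rewrite -expRD ler_expR -[X in X + _]mul1r -mulrDl ler_wnM2r//.
exact: mxtrace_deflate.
Qed.

(** * Discretisation *)

Section Norms.
Variable R : realType.
Local Open Scope classical_set_scope.

Lemma l2_normE k (v : 'cV[R]_k) : l2_norm v = Num.sqrt (nsq v).
Proof. by rewrite nsqE. Qed.

Lemma l2_norm_ge0 k (v : 'cV[R]_k) : 0 <= l2_norm v.
Proof. exact: sqrtr_ge0. Qed.

Lemma sqr_l2_norm k (v : 'cV[R]_k) : l2_norm v ^+ 2 = nsq v.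
Proof. by rewrite l2_normE sqr_sqrtr// nsq_ge0. Qed.

Lemma l2_normZ k (a : R) (v : 'cV[R]_k) : l2_norm (a *: v) = `|a| * l2_norm v.
Proof. by rewrite !l2_normE nsqZ sqrtrM ?sqr_ge0// sqrtr_sqr. Qed.

Lemma dotv_sqr_le k (u v : 'cV[R]_k) : dotv u v ^+ 2 <= nsq u * nsq v.
Proof.
have [u0|u0] := eqVneq (nsq u) 0.
  by rewrite u0 mul0r (nsq_eq0 u0) /dotv big1 ?expr0n// => i _; rewrite mxE mul0r.
have upos : 0 < nsq u by rewrite lt_neqAle eq_sym u0 nsq_ge0.
by rewrite (nsq_proj v u0) -ler_pdivrMl// mulrC lerDl nsq_ge0.
Qed.

Lemma l2_norm_triangle k (u v : 'cV[R]_k) : l2_norm (u + v) <= l2_norm u + l2_norm v.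
Proof.
rewrite -ler_sqr ?nnegrE ?addr_ge0 ?l2_norm_ge0// sqrrD !sqr_l2_norm.
have -> : nsq (u + v) = nsq u + dotv u v *+ 2 + nsq v.
  by rewrite /nsq dotvDr !dotvDl (dotvC v u) mulr2n; ring.
rewrite lerD2r lerD2l lerMn2r/=; apply: le_trans (ler_norm _) _.
rewrite -ler_sqr ?nnegrE ?mulr_ge0 ?l2_norm_ge0// exprMn !sqr_l2_norm real_normK ?num_real//.
exact: dotv_sqr_le.
Qed.

Variables (m n : nat) (A : 'M[R]_(m, n)).

Lemma sqr_hs_norm : hs_norm A ^+ 2 = \tr (gram A).
Proof.
rewrite sqr_sqrtr; last by rewrite sumr_ge0// => i _; rewrite sumr_ge0// => j _; rewrite sqr_ge0.
rewrite exchange_big; apply: eq_bigr => j _ /=; rewrite gram_diag nsqE.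
by apply: eq_bigr => i _; rewrite mxE.
Qed.

Lemma hs_norm_ge0 : 0 <= hs_norm A. Proof. exact: sqrtr_ge0. Qed.

Lemma l2_norm_mul_hs x : l2_norm (A *m x) <= hs_norm A * l2_norm x.
Proof.
rewrite -ler_sqr ?nnegrE ?mulr_ge0 ?l2_norm_ge0 ?hs_norm_ge0//.
rewrite exprMn !sqr_l2_norm sqr_sqrtr; last first.
  by rewrite sumr_ge0// => i _; rewrite sumr_ge0// => j _; rewrite sqr_ge0.
rewrite nsqE mulr_suml; apply: ler_sum => i _.
have -> : (A *m x) i 0 = dotv (row i A)^T x.
  by rewrite mxE; apply: eq_bigr => j _; rewrite !mxE.
apply: le_trans (dotv_sqr_le _ _) _; rewrite nsqE le_eqVlt; apply/orP; left.
by apply/eqP; congr (_ * _); apply: eq_bigr => j _; rewrite !mxE.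
Qed.

Let ball_image := [set l2_norm (A *m x) | x in [set x : 'cV[R]_n | l2_norm x <= 1]].

Lemma l2_norm0 k : l2_norm (0 : 'cV[R]_k) = 0.
Proof. by rewrite l2_normE /nsq /dotv big1 ?sqrtr0// => i _; rewrite mxE mul0r. Qed.

Lemma ball_image_hs : ubound ball_image (hs_norm A).
Proof.
move=> _ [x /= x1 <-]; apply: le_trans (l2_norm_mul_hs x) _.
by rewrite -[leRHS]mulr1 ler_wpM2l ?hs_norm_ge0.
Qed.

Lemma ball_image_has_sup : has_sup ball_image.
Proof.
split; last by exists (hs_norm A); exact: ball_image_hs.
by exists (l2_norm (A *m 0)), 0 => //=; rewrite l2_norm0.
Qed.

Lemma op_norm_le_hs : op_norm A <= hs_norm A.
Proof. by apply: ge_sup; [case: ball_image_has_sup|exact: ball_image_hs]. Qed.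

Lemma l2_norm_mul_op x : l2_norm (A *m x) <= op_norm A * l2_norm x.
Proof.
have [x0|x0] := eqVneq (l2_norm x) 0.
  have -> : x = 0 by apply: nsq_eq0; rewrite -sqr_l2_norm x0 expr0n.
  by rewrite mulmx0 !l2_norm0 mulr0.
have xp : 0 < l2_norm x by rewrite lt_neqAle eq_sym x0 l2_norm_ge0.
rewrite -ler_pdivrMr// mulrC -(gtr0_norm (x := (l2_norm x)^-1)) ?invr_gt0//.
rewrite -l2_normZ scalemxAr; apply: ub_le_sup; first by case: ball_image_has_sup.
exists ((l2_norm x)^-1 *: x) => //=.
by rewrite l2_normZ gtr0_norm ?invr_gt0// mulVf.
Qed.

Hypothesis A0 : A != 0.

Lemma op_norm_gt0 : 0 < op_norm A.
Proof.
rewrite ltNge; apply/negP => op0.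
have Ax (x : 'cV[R]_n) : A *m x = 0.
  apply: nsq_eq0; rewrite -sqr_l2_norm; apply/eqP; rewrite sqrf_eq0 eq_le l2_norm_ge0 andbT.
  by apply: le_trans (l2_norm_mul_op x) _; rewrite mulr_le0_ge0 ?l2_norm_ge0.
move/eqP: A0; apply; apply/matrixP => i j.
by have /matrixP/(_ i 0) := Ax (delta_mx j 0); rewrite -colE !mxE.
Qed.

Lemma contraction_op : contraction ((op_norm A)^-1 *: A).
Proof.
move=> x; rewrite -!sqr_l2_norm ler_sqr ?nnegrE ?l2_norm_ge0//.
rewrite -scalemxAl l2_normZ gtr0_norm ?invr_gt0 ?op_norm_gt0//.
by rewrite mulrC ler_pdivrMr ?op_norm_gt0// mulrC l2_norm_mul_op.
Qed.

Lemma mxtrace_gram_op :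
  \tr (gram ((op_norm A)^-1 *: A)) = hs_norm A ^+ 2 / op_norm A ^+ 2.
Proof.
have -> : gram ((op_norm A)^-1 *: A) = (op_norm A ^+ 2)^-1 *: gram A.
  apply/matrixP => j k; rewrite gram_dot [RHS]mxE gram_dot /dotv mulr_sumr.
  by apply: eq_bigr => i _; rewrite !mxE expr2 invfM; ring.
by rewrite sqr_hs_norm mxtraceZ mulrC.
Qed.

(** From [op_norm A <= hs_norm A]; it makes the exponent of the theorem positive. *)
Lemma stable_rank_ge1 : 1 <= (stable_rank A)%:~R :> R.
Proof.
rewrite ler1z /stable_rank floor_ge_int -?[1%:~R]/(1 : R)//.
rewrite ler_pdivlMr ?exprn_gt0 ?op_norm_gt0// mul1r.
by rewrite ler_sqr ?nnegrE ?hs_norm_ge0 ?(ltW op_norm_gt0) ?op_norm_le_hs.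
Qed.

Lemma stable_rank_le : (stable_rank A)%:~R <= hs_norm A ^+ 2 / op_norm A ^+ 2.
Proof. exact: floor_le. Qed.

End Norms.

(** * Tails and concentration of a real random variable *)

Section Concentration.
Context (d : measure_display) (T : measurableType d) (R : realType) (P : probability T R).
Local Open Scope classical_set_scope.

Lemma prob_fibers (K : finType) (f : T -> K) (G : pred K) :
  (forall k, measurable (f @^-1` [set k])) ->
  measurable [set w | G (f w)] /\
  P [set w | G (f w)] = (\sum_(k | G k) P (f @^-1` [set k]))%E.
Proof.
move=> mf.
have -> : [set w | G (f w)] = \bigcup_(k in [set` G]) f @^-1` [set k].
  apply/seteqP; split=> [w Gw|w [k Gk fk]] /=; first by exists (f w).
  by rewrite fk.
split; first by apply: fin_bigcup_measurable.
rewrite measure_fin_bigcup//; last by move=> i j _ _ [w [/= -> ]].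
rewrite -(@bigfs _ _ _ _ (index_enum K)) ?index_enum_uniq// => i _.
by rewrite mem_index_enum.
Qed.

Lemma measurable_norm_le (X : {RV P >-> R}) (a t : R) :
  measurable [set w | `|X w - a| <= t].
Proof.
have -> : [set w | `|X w - a| <= t] = X @^-1` `[a - t, a + t].
  by apply/seteqP; split=> w /=; rewrite in_itv /= ler_norml => /andP[h1 h2];
    apply/andP; split; lra.
by rewrite -[X in measurable X]setTI; exact: measurable_funP.
Qed.

Lemma measurable_norm_ge (X : T -> R) (r : R) : measurable_fun [set: T] X ->
  measurable [set w | r <= `|X w|].
Proof.
move=> mX.
have -> : [set w | r <= `|X w|] = X @^-1` (`]-oo, - r] `|` `[r, +oo[).
  apply/seteqP; split=> w /=; rewrite !in_itv /= andbT ler_normr lerNr.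
    by move=> /orP[]; [right|left].
  by case=> ->; rewrite ?orbT.
rewrite -[X in measurable X]setTI; apply: mX => //; exact: measurableU.
Qed.

Lemma prob_tail (X : T -> R) (eta : R) : measurable_fun [set: T] X -> 0 < eta ->
  exists r, 0 < r /\ (P [set w | (r <= `|X w|)%R] <= eta%:E)%E.
Proof.
move=> mX eta0; pose F (k : nat) := [set w | k%:R <= `|X w|].
have mF k : measurable (F k) by exact: measurable_norm_ge.
have F0 : \bigcap_k F k = set0.
  apply/seteqP; split=> // w Fw.
  have := archi_boundP (normr_ge0 (X w)); have := Fw (Num.bound `|X w|) I.
  by rewrite /F /= => /le_lt_trans /[apply]; rewrite ltxx.
have cF : P \o F @ \oo --> 0%E.
  rewrite -(measure0 P) -F0; apply: nonincreasing_cvg_mu => //.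
  - by apply: le_lt_trans (probability_le1 P (mF 0%N)) _; rewrite ltry.
  - by rewrite F0.
  - move=> i j ij; apply/subsetPset => w /=; apply: le_trans; by rewrite ler_nat.
have : nbhs (0%E : \bar R) [set x | (x < eta%:E)%E].
  by apply: open_nbhs_nbhs; split; [exact: open_ereal_lt_ereal|rewrite /= lte_fin].
move=> /cF[k _ Hk]; exists k.+1%:R; split; first by rewrite ltr0n.
by apply: ltW; apply: (Hk k.+1) => /=.
Qed.

(* Otherwise a bounded sequence of centres, with radii tending to [0], would
   accumulate at a point of mass at least [p']. *)
Lemma concentration_radius (X : {RV P >-> R}) (p p' : R) : p < p' ->
  (forall a, (P [set w | (`|X w - a| <= 0)%R] <= p%:E)%E) ->
  exists t, 0 < t /\ forall a, (P [set w | (`|X w - a| <= t)%R] <= p'%:E)%E.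
Proof.
move=> pp' H; apply: contrapT => Hn.
have p0 : 0 <= p by rewrite -lee_fin; apply: le_trans (H 0).
have p'0 : 0 < p' by exact: le_lt_trans pp'.
have {}Hn k : exists a, (p'%:E < P [set w | (`|X w - a| <= k.+1%:R^-1)%R])%E.
  apply: contrapT => Hk; apply: Hn; exists k.+1%:R^-1; split; first by rewrite invr_gt0.
  by move=> a; rewrite leNgt; apply/negP => Ha; apply: Hk; exists a.
have [a Ha] := boolp.choice Hn.
have mX : measurable_fun [set: T] X by exact: measurable_funP.
have [r [r0 Hr]] := prob_tail mX p'0.
(* An interval centred farther out would lie in a tail of mass at most [p']. *)
have ba k : `|a k| <= r + 1.
  rewrite leNgt; apply/negP => ar.
  have := Ha k; rewrite ltNge => /negP; apply; apply: le_trans Hr.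
  apply: le_measure; rewrite ?inE; [exact: measurable_norm_le|exact: measurable_norm_ge|].
  move=> w /= Xw; have k1 : k.+1%:R^-1 <= 1 :> R by rewrite invf_le1// ler1n.
  have h := ler_normB (X w) (X w - a k); rewrite subKr in h.
  by move: (le_trans Xw k1) h ar; lra.
have [|f fincr /cvg_ex[/= l fl]] := bolzano_weierstrass (u_ := a).
  exists (r + 1); split; first exact: num_real.
  by move=> M rM k _ /=; apply: le_trans (ba k) (ltW rM).
have fk k : (k <= f k)%N.
  elim: k => // k IH; apply: leq_ltn_trans IH _.
  by rewrite ltnNge; have := fincr k.+1 k; rewrite ltnn leEnat => ->.
(* Half of the radius is for the distance from [l] to a centre [a j], the other half for the
   interval around it. *)
pose F k := [set w | `|X w - l| <= 2 * k.+1%:R^-1].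
have mF k : measurable (F k) by exact: measurable_norm_le.
have PF k : (p'%:E <= P (F k))%E.
  have k0 : 0 < k.+1%:R^-1 :> R by rewrite invr_gt0.
  have /cvgrPdist_le/(_ _ k0)[N _ HN] := fl.
  pose j := f (maxn N k).
  have jl : `|l - a j| <= k.+1%:R^-1 by apply: HN; rewrite /= leq_maxl.
  have jk : j.+1%:R^-1 <= k.+1%:R^-1 :> R.
    rewrite lef_pV2 ?posrE// ler_nat ltnS; apply: leq_trans (fk _).
    exact: leq_maxr.
  apply: le_trans (ltW (Ha j)) _; apply: le_measure; rewrite ?inE.
  - exact: measurable_norm_le.
  - exact: mF.
  - move=> w /= Xw; apply: le_trans (ler_distD (a j) _ _) _.
    rewrite mulr_natl mulr2n lerD//; first exact: le_trans Xw jk.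
    by rewrite distrC.
have cF : P \o F @ \oo --> P (\bigcap_k F k).
  apply: nonincreasing_cvg_mu => //.
  - by apply: le_lt_trans (probability_le1 P (mF 0%N)) _; rewrite ltry.
  - exact: bigcap_measurable.
  - move=> i j ij; apply/subsetPset => w /= /le_trans; apply.
    by rewrite ler_pM2l// lef_pV2 ?posrE// ler_nat ltnS.
have lb : (p'%:E <= P (\bigcap_k F k))%E.
  apply: (cvge_ge _ cF); near=> k; exact: PF.
have ub : (P (\bigcap_k F k) <= p%:E)%E.
  apply: le_trans (H l); apply: le_measure; rewrite ?inE.
  - exact: bigcap_measurable.
  - exact: measurable_norm_le.
  - move=> w /= Fw; rewrite leNgt; apply/negP => x0.
    set x := `|X w - l| in x0.
    have x2 : 0 <= 2 / x by rewrite divr_ge0// ltW.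
    have := archi_boundP x2; set k := Num.bound _ => xk.
    have := Fw k I; rewrite /F /= -/x ler_pdivlMr ?ltr0n//.
    move: xk; rewrite ltr_pdivrMr// -natr1; lra.
by have := le_trans lb ub; rewrite lee_fin leNgt pp'.
Unshelve. all: by end_near. Qed.

End Concentration.

Section Quantization.
Variable R : realType.
Local Open Scope classical_set_scope.

(* The cell of [z] records which of the points [- r + j * h] lie below [z];
   each nonempty cell is represented by one of its own points. *)
Lemma quantization (h r : R) : 0 < h -> exists (K : finType) (D : R -> K) (y : K -> R),
  (forall k, measurable (D @^-1` [set k])) /\
  forall z, `|z| < r -> `|z - y (D z)| <= h.
Proof.
(* The two extra indices keep the grid point just above any [z] with [|z| < r] in range. *)
move=> h0; pose N := (Num.bound (2 * r / h)).+2.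
pose c (j : nat) : R := - r + j%:R * h.
pose D z : {set 'I_N} := [set j : 'I_N | c j <= z]%SET.
pose y (k : {set 'I_N}) : R := xget 0 [set z | D z = k].
exists {set 'I_N}, D, y; split=> [k|z zr].
  have -> : D @^-1` [set k] =
      \bigcap_(j in [set: 'I_N]) (if j \in k then `[c j, +oo[ else `]-oo, c j[).
    apply/seteqP; split=> [z /= zk j _|z /= zk].
      by rewrite -zk finset.inE; case: ifPn; rewrite /= in_itv /= ?andbT// ltNge.
    apply/finset.setP => j; rewrite finset.inE; have := zk j I.
    by case: ifPn => _; rewrite /= in_itv /= ?andbT// ltNge => /negbTE.
  apply: fin_bigcap_measurable => // j _; case: ifP => _ //.
have DyD : D (y (D z)) = D z by apply: (xgetPex 0 (P := [set u | D u = D z])); exists z.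
have cmp (j : 'I_N) : (c j <= y (D z)) = (c j <= z).
  by have /finset.setP/(_ j) := DyD; rewrite !finset.inE.
move: zr; rewrite ltr_norml => /andP[zr1 zr2].
pose q := (z + r) / h.
have q0 : 0 <= q by rewrite divr_ge0 ?(ltW h0)//; lra.
have /andP[j1 j2] := truncn_itv q0; set j := Num.truncn q in j1 j2.
have jN : (j.+1 < N)%N.
  rewrite /N ltnS ltnS -(ler_nat R) ltW//.
  have q2 : q <= 2 * r / h by rewrite ler_pM2r ?invr_gt0//; lra.
  apply: le_lt_trans (le_trans j1 q2) _; apply: archi_boundP.
  exact: le_trans q0 q2.
have := cmp (Ordinal (ltnW jN)); have := cmp (Ordinal jN); rewrite /c /=.
move: j1 j2; rewrite /q ler_pdivlMr// ltr_pdivrMr// => j1 j2.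
set x := y _; rewrite -natr1 in j2 *.
rewrite [X in _ = X -> _]lt_geF; last by lra.
move=> /negbT; rewrite -ltNge => x2.
rewrite [X in _ = X -> _](_ : _ = true); last by lra.
move=> x1; rewrite ler_norml; lra.
Qed.

End Quantization.

(** * Transfer from finitely supported laws to general ones *)

Section Transfer.
Context (d : measure_display) (T : measurableType d) (R : realType) (P : probability T R).
Variables (n : nat) (X : 'I_n -> {RV P >-> R}).
Local Open Scope classical_set_scope.

Lemma measurable_l2_norm_le m (A : 'M[R]_(m, n)) u r : 0 <= r ->
  measurable [set w | l2_norm (A *m random_vector X w - u) <= r].
Proof.
move=> r0; pose g w : R := \sum_i (\sum_j A i j * X j w - u i 0) ^+ 2.
have mg : measurable_fun [set: T] g.
  apply: measurable_sum => i; apply: measurable_realfun.measurable_funX.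
  apply: measurable_realfun.measurable_funB => //.
  by apply: measurable_sum => j; apply: measurable_realfun.measurable_funM.
have -> : [set w | l2_norm (A *m random_vector X w - u) <= r] =
    [set: T] `&` g @^-1` `]-oo, r ^+ 2].
  have gE w : g w = l2_norm (A *m random_vector X w - u) ^+ 2.
    rewrite sqr_l2_norm nsqE; apply: eq_bigr => i _; rewrite !mxE.
    by congr ((_ - _) ^+ 2); apply: eq_bigr => j _; rewrite mxE.
  rewrite setTI; apply/seteqP; split=> w /=; rewrite in_itv /= gE;
    by rewrite ler_sqr ?nnegrE ?l2_norm_ge0.
exact: mg.
Qed.

Hypothesis indep : mutually_independent X.
Variables (t p : R).
Hypothesis t0 : 0 < t.
Hypothesis p0 : 0 < p.
Hypothesis conc : forall i a, (P [set w | (`|X i w - a| <= t)%R] <= p%:E)%E.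

Let fineP (A : set T) : measurable A -> (fine (P A))%:E = P A.
Proof. by move=> mA; rewrite fineK// fin_num_measure. Qed.

Section Discretized.
Variables (K : finType) (D : R -> K) (y : K -> R).
Hypothesis mD : forall k, measurable (D @^-1` [set k]).

Definition cell_prob i k : R := fine (P (X i @^-1` (D @^-1` [set k]))).

Lemma measurable_cell i k : measurable (X i @^-1` (D @^-1` [set k])).
Proof. by rewrite -[X in measurable X]setTI; exact: measurable_funP. Qed.

Lemma cell_prob_ge0 i k : 0 <= cell_prob i k.
Proof. exact: fine_ge0. Qed.

Lemma sum_cell_prob i (G : pred K) :
  (\sum_(k | G k) cell_prob i k)%:E = P [set w | G (D (X i w))].
Proof.
have [_ ->] := prob_fibers P (f := fun w => D (X i w)) G (measurable_cell i).
rewrite -sumEFin; apply: eq_bigr => k _; apply: fineP; exact: measurable_cell.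
Qed.

Lemma cell_prob_sum i : \sum_k cell_prob i k = 1.
Proof.
apply: EFin_inj; rewrite (sum_cell_prob i xpredT).
by rewrite (_ : [set w | _] = [set: T]) ?probability_setT//; apply/seteqP; split.
Qed.

Let F w : {ffun 'I_n -> K} := [ffun i => D (X i w)].

Lemma fiber_cells kap : F @^-1` [set kap] =
  \bigcap_(i in [set` [set: 'I_n]%SET]) (X i @^-1` (D @^-1` [set (kap i)])).
Proof.
apply/seteqP; split=> [w /= <- i _ /=|w /= H]; first by rewrite ffunE.
by apply/ffunP => i; rewrite ffunE; apply: H; rewrite /= finset.inE.
Qed.

Lemma measurable_fiber kap : measurable (F @^-1` [set kap]).
Proof.
by rewrite fiber_cells; apply: fin_bigcap_measurable => // i _; exact: measurable_cell.
Qed.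

(** Independence turns the joint law of the cell indices into the product law behind [mean]. *)
Lemma prob_cells (G : pred {ffun 'I_n -> K}) :
  P [set w | G (F w)] = (mean cell_prob (fun kap => (G kap)%:R))%:E.
Proof.
have [_ ->] := prob_fibers P G measurable_fiber.
rewrite /mean -sumEFin big_mkcond; apply: eq_bigr => kap _.
case: (G kap); last by rewrite mulr0.
rewrite mulr1 fiber_cells indep// -prodEFin.
by apply: eq_big => [i|i _]; [rewrite finset.inE|rewrite fineP//; exact: measurable_cell].
Qed.

Variables (h r eta : R).
Hypothesis Dy : forall z, `|z| < r -> `|z - y (D z)| <= h.
Hypothesis ht : h <= t.
(** One tail event for the sum controls all coordinates at once. *)
Let Y w : R := \sum_i `|X i w|.
Let tail := [set w | r <= `|Y w|].
Hypothesis tailE : (P tail <= eta%:E)%E.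

Let mtail : measurable tail.
Proof.
apply: measurable_norm_ge; apply: measurable_sum => i.
exact: measurableT_comp.
Qed.

Let not_tail w i : ~ tail w -> `|X i w| < r.
Proof.
move=> nt; rewrite ltNge; apply/negP => rX; apply: nt; rewrite /tail /=.
apply: le_trans rX _; rewrite (@ger0_norm _ (Y w)) ?sumr_ge0//.
by rewrite /Y (bigD1 i) //= lerDl sumr_ge0.
Qed.

(** Off the tail, rounding moves [X i] by at most [h <= t]. The interval thus grows to radius [2 t]
    and is covered by two of radius [t]. *)
Lemma cell_prob_conc i a :
  \sum_(k | `|y k / t - a| <= 1) cell_prob i k <= 2 * p + eta.
Proof.
rewrite -lee_fin sum_cell_prob.
have mI b : measurable [set w | `|X i w - b| <= t] by exact: measurable_norm_le.
apply: (@le_trans _ _ (P (tail `|` ([set w | `|X i w - (t * a - t)| <= t] `|`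
    [set w | `|X i w - (t * a + t)| <= t])))).
  apply: le_measure; rewrite ?inE.
  - by have [] := prob_fibers P (f := fun w => D (X i w))
      (fun k => `|y k / t - a| <= 1) (measurable_cell i).
  - by apply: measurableU => //; exact: measurableU.
  - move=> w /= H; have [tw|/(not_tail i)/Dy H2] := pselect (tail w); [by left|right].
    have {}H : `|y (D (X i w)) - t * a| <= t.
      rewrite (_ : _ - _ = t * (y (D (X i w)) / t - a)); last by field; rewrite gt_eqF.
      by rewrite normrM gtr0_norm// -[leRHS]mulr1 ler_pM2l.
    have aux (x z c : R) : `|z - c| <= t -> `|x - z| <= h ->
        `|x - (c - t)| <= t \/ `|x - (c + t)| <= t.
      move: ht; rewrite !ler_norml => ? /andP[? ?] /andP[? ?].
      by have [?|?] := lerP x c; [left|right]; apply/andP; split; lra.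
    exact: aux H H2.
apply: le_trans (measureU2 P mtail (measurableU _ _ (mI _) (mI _))) _.
rewrite addrC mulr_natl mulr2n !EFinD leeD//.
by apply: le_trans (measureU2 P (mI _) (mI _)) _; apply: leeD; exact: conc.
Qed.

Variables (m : nat) (A : 'M[R]_(m, n)) (u : 'cV[R]_m).
Hypothesis A0 : A != 0.
Hypothesis hn : h * n.+1%:R <= t.
Hypothesis h_ge0 : 0 <= h.
Let tau := hs_norm A ^+ 2 / op_norm A ^+ 2.
Let yv (kap : {ffun 'I_n -> K}) : 'cV[R]_n := \col_i y (kap i).
Let good (kap : {ffun 'I_n -> K}) := l2_norm (A *m yv kap - u) <= 2 * (t * hs_norm A).

(** Off the tail, rounding moves the vector by at most [t] in Euclidean norm, hence its image by at
    most [t * hs_norm A]. *)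
Lemma prob_le_tail_good :
  (P [set w | (l2_norm (A *m random_vector X w - u) <= t * hs_norm A)%R] <=
   eta%:E + (mean cell_prob (fun kap => (good kap)%:R))%:E)%E.
Proof.
have [mgood _] := prob_fibers P (f := F) good measurable_fiber.
apply: (@le_trans _ _ (P (tail `|` [set w | good (F w)]))).
  apply: le_measure; rewrite ?inE.
  - by apply: measurable_l2_norm_le; rewrite mulr_ge0 ?(ltW t0) ?hs_norm_ge0.
  - exact: measurableU.
  - move=> w /= H; have [tw|nt] := pselect (tail w); [by left|right].
    rewrite /good /=; set z := random_vector X w in H.
    have -> : A *m yv (F w) - u = A *m (yv (F w) - z) + (A *m z - u).
      by rewrite mulmxBr addrA subrK.
    apply: le_trans (l2_norm_triangle _ _) _.
    rewrite mulr_natl mulr2n lerD//; apply: le_trans (l2_norm_mul_hs _ _) _.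
    rewrite mulrC ler_wpM2r ?hs_norm_ge0//.
    rewrite -ler_sqr ?nnegrE ?l2_norm_ge0 ?(ltW t0)// sqr_l2_norm nsqE.
    apply: (@le_trans _ _ (\sum_(i < n) h ^+ 2)).
      apply: ler_sum => i _; rewrite !mxE ffunE -real_normK ?num_real//.
      by rewrite ler_sqr ?nnegrE// distrC; apply: Dy; exact: not_tail.
    rewrite sumr_const card_ord -mulr_natr.
    apply: (@le_trans _ _ ((h * n.+1%:R) ^+ 2)); last first.
      by rewrite ler_sqr ?nnegrE ?mulr_ge0// ltW.
    rewrite exprMn ler_wpM2l ?sqr_ge0// -natrX ler_nat.
    by rewrite -mulnn (leq_trans (leqnSn n))// leq_pmulr.
apply: le_trans (measureU2 P mtail mgood) _.
by rewrite -(prob_cells good); apply: leeD.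
Qed.

(** Exponential Markov inequality: on [good] the rescaled vector has squared norm at most
    [4 * tau]. *)
Lemma mean_good_le :
  mean cell_prob (fun kap => (good kap)%:R) <=
  expR (2 * tau) * mean cell_prob (fun kap => gk (((op_norm A)^-1 *: A) *m
    valv (fun i k => y k / t) kap - (op_norm A * t)^-1 *: u)).
Proof.
rewrite -meanZ; apply: ler_mean => [|kap]; first exact: cell_prob_ge0.
have s0 := op_norm_gt0 A0.
have -> : ((op_norm A)^-1 *: A) *m valv (fun i k => y k / t) kap - (op_norm A * t)^-1 *: u =
    (op_norm A * t)^-1 *: (A *m yv kap - u).
  have -> : valv (fun i k => y k / t) kap = t^-1 *: yv kap.
    by apply/colP => i; rewrite !mxE mulrC.
  by rewrite -scalemxAr -scalemxAl scalerA scalerBr invfM mulrC.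
have [g|_] := boolP (good kap); last by rewrite mulr_ge0 ?expR_ge0.
rewrite /gk -expRD -[leLHS]expR0 ler_expR nsqZ -sqr_l2_norm subr_ge0.
rewrite ler_pdivrMr// exprVn ler_pdivrMl ?exprn_gt0 ?mulr_gt0//.
have -> : (op_norm A * t) ^+ 2 * (2 * tau * 2) = (2 * (t * hs_norm A)) ^+ 2.
  by rewrite /tau; field; rewrite gt_eqF.
by rewrite ler_sqr ?nnegrE ?l2_norm_ge0// !mulr_ge0 ?hs_norm_ge0 ?(ltW t0).
Qed.

Lemma prob_le_discretized : 2 * (768 * (2 * p + eta)) <= 1 -> 0 <= eta ->
  (P [set w | (l2_norm (A *m random_vector X w - u) <= t * hs_norm A)%R] <=
   (eta + expR (2 * tau) * expR (tau * ln (2 * (768 * (2 * p + eta)))))%:E)%E.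
Proof.
move=> small eta0; apply: le_trans prob_le_tail_good _.
rewrite -EFinD lee_fin lerD2l; apply: le_trans mean_good_le _.
rewrite ler_wpM2l ?expR_ge0// /tau -(mxtrace_gram_op A).
apply: mean_gk_le => //.
- exact: cell_prob_ge0.
- exact: cell_prob_sum.
- by rewrite ltr_pwDl// mulr_gt0.
- exact: cell_prob_conc.
- exact: contraction_op.
Qed.

End Discretized.

Lemma prob_l2_le m (A : 'M[R]_(m, n)) u : A != 0 ->
  16 * (2 * (768 * (3 * p))) <= 1 ->
  (P [set w | (l2_norm (A *m random_vector X w - u) <= t * hs_norm A)%R] <=
   (expR (hs_norm A ^+ 2 / op_norm A ^+ 2 * ln (16 * (2 * (768 * (3 * p))))))%:E)%E.
Proof.
move=> A0 small; apply/lee_addgt0Pr => e e0.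
(* The bound by [p] gives [2 * p + eta <= 3 * p]; the bound by [e] absorbs the tail. *)
pose eta := Num.min p e.
have eta0 : 0 < eta by rewrite lt_min p0 e0.
have etap : eta <= p by rewrite ge_min lexx.
have etae : eta <= e by rewrite ge_min lexx orbT.
pose h := t / n.+1%:R.
have h0 : 0 < h by rewrite divr_gt0.
have hn : h * n.+1%:R <= t by rewrite /h divfK.
have ht : h <= t by rewrite ler_pdivrMr// -[leLHS]mulr1 ler_pM2l// ler1n.
have mY : measurable_fun [set: T] (fun w => \sum_i `|X i w|).
  by apply: measurable_sum => i; exact: measurableT_comp.
have [r [_ Hr]] := prob_tail P mY eta0.
have [K [D [y [mD Dy]]]] := quantization r h0.
have [k k0 kE] : exists2 k : R, 0 < k & forall a, 2 * (768 * a) = k * a.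
  by exists (2 * 768) => [|a]; [rewrite pmulr_rgt0 ltr0n|rewrite mulrA].
rewrite kE in small *; set c := k * (3 * p) in small *.
have c0 : 0 < c by rewrite !mulr_gt0.
set c' := k * (2 * p + eta).
have cc : c' <= c by rewrite ler_pM2l//; lra.
have c'0 : 0 < c' by rewrite mulr_gt0//; lra.
have c'1 : c' <= 1 by lra.
have := @prob_le_discretized K D y mD h r eta Dy ht Hr m A u A0 hn (ltW h0).
rewrite kE -/c' => /(_ c'1 (ltW eta0)) /le_trans; apply.
rewrite -EFinD lee_fin addrC lerD//.
have t_ge0 : 0 <= hs_norm A ^+ 2 / op_norm A ^+ 2 by rewrite divr_ge0 ?sqr_ge0.
rewrite -expRD ler_expR (mulrC 2) -mulrDr ler_wpM2l//.
(* The factor [expR (2 * tau)] is at most [16] to the power [tau] and joins the constant. *)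
have e2 : 2 <= ln 16 :> R.
  rewrite -ler_expR lnK ?posrE ?ltr0n//.
  have -> : (2 : R) = 4%:R * 2^-1 by lra.
  rewrite expRM_natl.
  apply: (@le_trans _ _ (2 ^+ 4)).
    by rewrite lerXn2r ?nnegrE ?expR_ge0// expR_half_le2.
  by rewrite -natrX ler_nat.
rewrite lnM ?posrE ?ltr0n// lerD// ler_ln ?posrE//.
Qed.

End Transfer.

(** * The theorem, including [t = 0] and [p = 0] *)

Local Open Scope classical_set_scope.
Local Open Scope ring_scope.

Theorem theorem1p5 (R : realType) (eps : R) (heps0 : 0 < eps) (heps1 : eps < 1) :
  exists C : R, 0 < C /\
    forall (d : measure_display) (T : measurableType d) (P : probability T R)
      (n : nat) (X : 'I_n -> {RV P >-> R}) (t p : R),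
      mutually_independent X ->
      0 <= t -> 0 <= p ->
      (forall i : 'I_n,
        (concentration P (fun w => const_mx (X i w) : 'cV[R]_1) t <= p%:E)%E) ->
      forall (m : nat) (A : 'M[R]_(m, n)), A != 0 ->
        (concentration P (fun w => A *m random_vector X w) (t * hs_norm A)
          <= ((C * p) `^ ((1 - eps) * (stable_rank A)%:~R))%:E)%E.
Proof.
have [C [C0 CE]] : exists C : R, 0 < C /\ forall p, C * p = 16 * (2 * (768 * (3 * p))).
  by exists (16 * (2 * (768 * 3))); split; [rewrite !pmulr_rgt0 ?ltr0n|move=> p; ring].
(* The factor [2] pays for replacing [p] by the strictly larger [p' = 2 * p]. *)
exists (2 * C); split; first by rewrite mulr_gt0.
move=> d T P n X t p indep t0 p0 conc m A A0.
set s := (1 - eps) * _.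
have r1 := stable_rank_ge1 A0.
have s0 : 0 < s by rewrite mulr_gt0 ?subr_gt0//; lra.
apply: ub_ereal_sup => _ [u _ <-].
have conc' i (a : R) : (P [set w : T | (`|X i w - a| <= t)%R] <= p%:E)%E.
  apply: le_trans (conc i); apply: ereal_sup_ubound; exists (const_mx a) => //.
  congr (P _); apply/seteqP; split=> w /=;
    by rewrite /l2_norm big_ord1 !mxE sqrtr_sqr.
(* Slack in the probability buys a positive radius when [t = 0]. *)
have radius p' : p < p' -> exists t', [/\ 0 < t', t <= t' &
    forall i (a : R), (P [set w : T | (`|X i w - a| <= t')%R] <= p'%:E)%E].
  move=> pp'; have [t_gt0|t_le0] := ltP 0 t.
    exists t; split=> // i a; apply: le_trans (conc' i a) _.
    by rewrite lee_fin ltW.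
  have tE : t = 0 by apply/eqP; rewrite eq_le t_le0.
  rewrite tE in conc' *.
  have [t' Ht'] := boolp.choice (fun i => concentration_radius pp' (conc' i)).
  (* The default [1] keeps the minimum positive when [n = 0]. *)
  pose tm := \big[Num.min/1]_i t' i.
  have tm0 : 0 < tm by apply: lt_bigmin => // i _; case: (Ht' i).
  exists tm; split=> [//||i a]; first exact: ltW.
  apply: le_trans ((Ht' i).2 a); apply: le_measure; rewrite ?inE.
  - exact: measurable_norm_le.
  - exact: measurable_norm_le.
  - by move=> w /= /le_trans; apply; exact: bigmin_le.
have key p' : p < p' ->
    (P [set w : T | (l2_norm (A *m random_vector X w - u) <= t * hs_norm A)%R] <=
     ((C * p') `^ s)%:E)%E.
  move=> pp'; have p'0 : 0 < p' by exact: le_lt_trans pp'.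
  have mE t' : 0 <= t' ->
      measurable [set w : T | l2_norm (A *m random_vector X w - u) <= t' * hs_norm A].
    by move=> ?; apply: measurable_l2_norm_le; rewrite mulr_ge0 ?hs_norm_ge0.
  (* For [C * p' > 1] the right-hand side exceeds one and the bound is trivial. *)
  have [small|big] := lerP (C * p') 1; last first.
    apply: le_trans (probability_le1 P (mE _ t0)) _.
    by rewrite lee_fin -(powRr0 (C * p')) ler_powR// ltW.
  have [t' [t'0 tt' Ht']] := radius p' pp'.
  apply: (@le_trans _ _ (P [set w : T | l2_norm (A *m random_vector X w - u) <= t' * hs_norm A])).
    apply: le_measure; rewrite ?inE; [exact: mE|exact/mE/ltW|].
    by move=> w /= /le_trans; apply; rewrite ler_wpM2r ?hs_norm_ge0.
  have := @prob_l2_le _ T R P n X indep t' p' t'0 p'0 Ht' m A u A0.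
  rewrite -CE => /(_ small) /le_trans; apply; rewrite lee_fin.
  have Cp0 : 0 < C * p' by rewrite mulr_gt0.
  (* The base is at most one, so the exponent may be lowered from the unrounded stable rank to
     [s]. *)
  rewrite /powR gt_eqF// ler_expR ler_wnM2r ?ln_le0//.
  apply: le_trans (stable_rank_le A); rewrite /s ger_pMl; lra.
have [p_gt0|p_le0] := ltP 0 p.
  have := key (2 * p); rewrite mulrA (mulrC C); apply; lra.
have pE : p = 0 by apply/eqP; rewrite eq_le p_le0.
rewrite pE mulr0 powR0 ?gt_eqF//; apply/lee_addgt0Pr => e e0.
rewrite add0e.
have e1 : 0 < e `^ s^-1 by rewrite powR_gt0.
(* For [p = 0], this [p'] makes the bound exactly the arbitrary [e]. *)
have := key (C^-1 * e `^ s^-1); rewrite pE mulr_gt0 ?invr_gt0// => /(_ isT) /le_trans; apply.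
by rewrite mulrA divff ?gt_eqF// mul1r -powRrM mulVf ?gt_eqF// powRr1// ltW.
Qed.
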